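(* Let $I\subset\mathbb{R}$ be an open bounded interval, let $k_0>0$ be a constant satisfying the nonlinear interpolation inequality (N) stated in the context, and let $0<k<k_0$. Let $(u_\varepsilon)\subset W^{2,2}(I)$ be a sequence (indexed by $\varepsilon\to0^+$) satisfying $\sup_\varepsilon F^k_\varepsilon(u_\varepsilon)<+\infty$. Then there exist a subsequence (not relabeled) and a function $u\in BV(I;\{\pm1\})$ such that $u_\varepsilon\to u$ in $L^1(I)$.
   Context: Standing assumptions on $W$: $W\colon\mathbb{R}\to[0,+\infty)$ is continuous, $W^{-1}(\{0\})=\{-1,1\}$, and there exists $c>0$ such that $W(s)\ge c\,(s-1)^2$ for all $s\ge0$ and $W(s)\ge c\,(s+1)^2$ for all $s\le 0$. For $\varepsilon,k>0$ and an open bounded interval $I$, the functional $F^k_\varepsilon\colon L^1(I)\to(-\infty,+\infty]$ is $$F^k_\varepsilon(u)=\int_I\Big(\frac{W(u)}{\varepsilon}-k\,\varepsilon\,(u')^2+\varepsilon^3(u'')^2\Big)dx\ \text{ if } u\in W^{2,2}(I),\qquad F^k_\varepsilon(u)=+\infty \text{ if } u\in L^1(I)\setminus W^{2,2}(I).$$ Inequality (N): the constant $k_0>0$ (which exists for such $W$) satisfies, for every $a<b$ and every $u\in W^{2,2}(a,b)$, $$k_0\int_a^b (u')^2\,dx \leq \frac{1}{(b-a)^2}\int_a^b W(u)\,dx+(b-a)^2\int_a^b(u'')^2\,dx.$$ $BV(I;\{\pm1\})$ is the set of functions of bounded variation on $I$ taking values in $\{-1,1\}$ almost everywhere. *)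

(* Defs.v *)
From HB Require Import structures.
From mathcomp Require Import all_boot all_order all_algebra.
From mathcomp Require Import all_classical all_reals all_analysis.
Set Implicit Arguments.
Unset Strict Implicit.
Unset Printing Implicit Defensive.
Import Order.TTheory GRing.Theory Num.Theory.
Import numFieldNormedType.Exports.
Local Open Scope classical_set_scope.
Local Open Scope ring_scope.

(* Elements of L^p(D), Sobolev and BV spaces are represented by functions
   R -> R whose values outside the open set D are irrelevant; every notion
   below is invariant under changes on null sets. *)

(* C^1_c(D): the functions are extended by zero outside D. *)
Definition test_function (R : realType) (D : set R) (phi : R -> R) : Prop :=
  [/\ forall x : R, derivable phi x 1,
      continuous (derive1 phi),
      compact (closure [set x | phi x != 0]) &
      closure [set x | phi x != 0] `<=` D].

Definition in_L1 (R : realType) (D : set R) (u : R -> R) : Prop :=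
  (@lebesgue_measure R).-integrable D (fun x => (u x)%:E).

Definition in_L2 (R : realType) (D : set R) (u : R -> R) : Prop :=
  measurable_fun D u /\
  (@lebesgue_measure R).-integrable D (fun x => (u x ^+ 2)%:E).

(* Weak derivative in L^2(D), tested against C^1_c(D) (as in Brezis,
   "Functional Analysis, Sobolev Spaces and PDEs", Chapter 8). *)
Definition weak_derivative (R : realType) (D : set R) (u v : R -> R) : Prop :=
  in_L2 D v /\
  forall phi, test_function D phi ->
    \int[@lebesgue_measure R]_(x in D) (u x * derive1 phi x) =
    - \int[@lebesgue_measure R]_(x in D) (v x * phi x).

Definition W12 (R : realType) (D : set R) (u : R -> R) : Prop :=
  in_L2 D u /\ exists v, weak_derivative D u v.

(* A representative of the weak derivative, which is unique up to a null
   set when D is open; meaningful only when W12 D u. *)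
Definition wderiv (R : realType) (D : set R) (u : R -> R) : R -> R :=
  xget (cst 0) [set v | weak_derivative D u v].

Definition W22 (R : realType) (D : set R) (u : R -> R) : Prop :=
  W12 D u /\ W12 D (wderiv D u).

Definition double_well (R : realType) (W : R -> R) : Prop :=
  [/\ continuous W,
      forall s, 0 <= W s,
      W @^-1` [set 0] = [set -1; 1] &
      exists c : R, [/\ 0 < c,
        forall s : R, 0 <= s -> c * (s - 1) ^+ 2 <= W s &
        forall s : R, s <= 0 -> c * (s + 1) ^+ 2 <= W s]].

Definition energy (R : realType) (W : R -> R) (D : set R) (k eps : R)
    (u : R -> R) : \bar R :=
  if pselect (W22 D u) then
    (\int[@lebesgue_measure R]_(x in D)
      (W (u x) / eps - k * eps * (wderiv D u x) ^+ 2
       + eps ^+ 3 * (wderiv D (wderiv D u) x) ^+ 2)%:E)%E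
  else +oo%E.

Definition nonlinear_interpolation (R : realType) (W : R -> R) (k0 : R) : Prop :=
  forall (a b : R) (u : R -> R), a < b -> W22 `]a, b[ u ->
  (k0%:E * \int[@lebesgue_measure R]_(x in `]a, b[) (wderiv `]a, b[ u x ^+ 2)%:E
   <= (1 / (b - a) ^+ 2)%:E * \int[@lebesgue_measure R]_(x in `]a, b[) (W (u x))%:E
    + ((b - a) ^+ 2)%:E *
      \int[@lebesgue_measure R]_(x in `]a, b[)
        (wderiv `]a, b[ (wderiv `]a, b[ u) x ^+ 2)%:E)%E.

(* The total variation of the distributional derivative of u in D, by duality.
   (The pointwise variation of realfun.v depends on the representative.) *)
Definition distr_variation (R : realType) (D : set R) (u : R -> R) : \bar R :=
  ereal_sup [set (\int[@lebesgue_measure R]_(x in D) (u x * derive1 phi x))%:E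
            | phi in [set phi : R -> R |
                test_function D phi /\ forall x, `|phi x| <= 1]].

Definition BV (R : realType) (D : set R) (u : R -> R) : Prop :=
  in_L1 D u /\ (distr_variation D u < +oo)%E.

Definition BV_pm1 (R : realType) (D : set R) (u : R -> R) : Prop :=
  BV D u /\
  {ae (@lebesgue_measure R), forall x, D x -> u x = -1 \/ u x = 1}.

Definition cvg_L1 (R : realType) (D : set R) (u_ : nat -> R -> R)
    (u : R -> R) : Prop :=
  (\int[@lebesgue_measure R]_(x in D) (`|u_ n x - u x|)%:E)%E @[n --> \oo]
    --> 0%E.

(* Main.v *)
Require Import Defs.
From HB Require Import structures.
From mathcomp Require Import all_boot all_order all_algebra.
From mathcomp Require Import all_classical all_reals all_analysis.
From mathcomp Require Import measurable_realfun ring lra.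
Set Implicit Arguments.
Unset Strict Implicit.
Unset Printing Implicit Defensive.
Import Order.TTheory GRing.Theory Num.Theory.
Import numFieldNormedType.Exports.
Local Open Scope classical_set_scope.
Local Open Scope ring_scope.

(** Let [u] be one of the functions and [eps] its parameter.

    Coercivity.  Cut [`]a, b[] into cells of length [l] slightly smaller than
    [eps] and add up the interpolation inequalities on the cells.  Since
    [eps / l] is close to 1 and [k < k0], the negative term [k * eps * u'^2] is
    absorbed by the two positive terms of the energy ([interpolation_cells],
    [energy_coercive]), and [W (u) / eps + eps * u'^2] has an integral bounded
    uniformly in [eps].

    Step functions.  On an interval of length about [eps], if this integral is
    below a fixed threshold, then [u] oscillates by less than 1/2 and cannot be
    small, so it has a constant sign ([low_energy_sign]).  The total energy is
    bounded, so all but a bounded number of cells have a sign, and this sign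
    changes a bounded number of times from one cell to the next.  Hence [u] is
    close in [L^1] to a function with values 1 and -1 and at most [M] jumps,
    with [M] independent of [eps] ([approx_by_steps]); on cells with a sign the
    error is [`|`|u| - 1|], controlled by the quadratic growth of [W] at the wells
    ([well_distance]).

    Compactness.  A function with values 1 and -1 and at most [M] jumps is a
    product of [M] functions [flip t], that is, it is determined by [M] points of
    [[a, b]].  Along a subsequence these points converge
    ([extract_alternation]), the step functions then converge almost
    everywhere, hence in [L^1] by domination ([cvg_L1_alternation]), and the
    limit is again such a product, which is of bounded variation
    ([BV_pm1_alternation]).

    Oscillation of a Sobolev function is estimated at Lebesgue points by testing
    the weak derivative against explicit C^1 plateaus ([weak_derivative_osc]);
    the same plateaus prove uniqueness of weak derivatives
    ([weak_derivative_unique]), which allows restricting to the cells. *)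

(** * Compactly supported ramps *)

Section ramp.
Variable R : realType.
Implicit Types (t x : R).

Definition pospart t : R := Num.max 0 t.

(** The difference quotient of the squared positive part at [t] differs from
    [2 * pospart t] by at most the increment, uniformly in [t]: this covers the
    kink at 0 without a case distinction on the position of [t]. *)
Lemma pospart_sqr_derive t :
  is_derive t 1 (fun s => pospart s ^+ 2) (2 * pospart t).
Proof.
have E : (h^-1 *: (((fun s => pospart s ^+ 2) \o shift t) (h *: 1) -
            pospart t ^+ 2)) @[h --> 0^'] --> 2 * pospart t.
  apply/cvgrPdist_le => e e0; near=> h => /=.
  have h0 : h != 0 by near: h; exact: nbhs_dnbhs_neq.
  have he : `|h| <= e by near: h; apply: dnbhs0_le.
  apply: le_trans he.
  rewrite /GRing.scale /= mulr1.
  rewrite -(ler_pM2l (x := `|h|)) ?normr_gt0// -normrM mulrBr mulVKf//.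
  rewrite -normrM -expr2 [leRHS]ger0_norm ?sqr_ge0// ler_norml /pospart.
  by apply/andP; split; case: (leP 0 (h + t)) => ?; case: (leP 0 t) => ?; nra.
by apply: DeriveDef; [apply/cvg_ex; eexists; exact: E | exact: cvg_lim E].
Unshelve. all: by end_near. Qed.

Definition hat t : R := 4 * (pospart t - 2 * pospart (t - 2^-1) + pospart (t - 1)).

(** A quadratic spline: a C^1 function which is 0 before 0, 1 after 1, and
    whose derivative is the tent [hat] of mass 1.  Differences of rescaled
    ramps supply all the test functions of the development. *)
Definition ramp t : R :=
  2 * (pospart t ^+ 2 - 2 * pospart (t - 2^-1) ^+ 2 + pospart (t - 1) ^+ 2).

Lemma ramp_derive t : is_derive t 1 ramp (hat t).
Proof.
have sh c : is_derive t 1 (fun s => pospart (s - c) ^+ 2) (2 * pospart (t - c)).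
  have h1 : is_derive t 1 (fun s : R => s - c) 1.
    by apply: is_derive_eq; rewrite subr0.
  have := @is_derive1_comp _ (fun s => pospart s ^+ 2) (fun s => s - c) t _ _
    (pospart_sqr_derive (t - c)) h1.
  by rewrite mulr1.
have := pospart_sqr_derive t; have := sh 2^-1; have := sh 1 => h1 h2 h3.
rewrite /ramp; apply: is_derive_eq.
by rewrite /GRing.scale /= /hat; ring.
Qed.

Lemma ramp_le0 t : t <= 0 -> ramp t = 0.
Proof.
move=> t0; rewrite /ramp /pospart !max_l ?expr0n/= ?mulr0 ?subr0 ?addr0 ?mulr0//; lra.
Qed.

Lemma ramp_ge1 t : 1 <= t -> ramp t = 1.
Proof. by move=> t0; rewrite /ramp /pospart !max_r; [field|lra..]. Qed.

Lemma ramp_bound t : 0 <= ramp t <= 1.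
Proof.
have [/ramp_le0->|t0] := leP t 0; first by rewrite lexx ler01.
have [/ramp_ge1->|t1] := leP 1 t; first by rewrite lexx ler01.
rewrite /ramp /pospart (max_r (ltW t0)) (@max_l _ _ 0 (t - 1)); last by lra.
by case: (leP 0 (t - 2^-1)) => ?; apply/andP; split; nra.
Qed.

Lemma hat_bound t : 0 <= hat t <= 2.
Proof.
by rewrite /hat /pospart; case: (leP 0 t) => ?; case: (leP 0 (t - 2^-1)) => ?;
  case: (leP 0 (t - 1)) => ?; apply/andP; split; lra.
Qed.

Lemma hat_out t : t <= 0 \/ 1 <= t -> hat t = 0.
Proof.
by rewrite /hat /pospart; case: (leP 0 t) => ?; case: (leP 0 (t - 2^-1)) => ?;
  case: (leP 0 (t - 1)) => ? []?; lra.
Qed.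

Lemma hat_continuous : continuous hat.
Proof.
have pc c : continuous (fun s => pospart (s - c)).
  move=> x; apply: (@continuous_max _ _ (cst 0) (fun s => s - c)).
    exact: cvg_cst.
  by apply: cvgB; [exact: cvg_id|exact: cvg_cst].
have p0 : continuous pospart by have := pc 0; under eq_fun do rewrite subr0.
move=> x; rewrite /hat; apply: cvgM; first exact: cvg_cst.
apply: cvgD; last exact: pc.
apply: cvgB; first exact: p0.
by apply: cvgM; [exact: cvg_cst|exact: pc].
Qed.

(** For [c + h <= d] this is a C^1 version of the indicator of an interval: it
    rises from 0 to 1 on [[c, c + h]] and falls back on [[d, d + h]].  Exchanging
    [c] and [d] changes the sign. *)
Definition bump (c d h t : R) := ramp ((t - c) / h) - ramp ((t - d) / h).

Lemma ramp_scale_derive (c h t : R) : 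
  is_derive t 1 (fun s => ramp ((s - c) / h)) (hat ((t - c) / h) / h).
Proof.
have h1 : is_derive t 1 (fun s : R => (s - c) / h) (h^-1).
  have : is_derive t 1 (fun s : R => h^-1 * (s - c)) (h^-1).
    by apply: is_derive_eq; rewrite subr0 /GRing.scale/= mulr1.
  by congr is_derive; apply/funext => s; rewrite mulrC.
exact: (@is_derive1_comp _ ramp (fun s => (s - c) / h) t _ _
  (ramp_derive ((t - c) / h)) h1).
Qed.

Lemma hat_scale_continuous (c h : R) : continuous (fun s => hat ((s - c) / h) / h).
Proof.
move=> x; apply: cvgM; last exact: cvg_cst.
apply: (@continuous_comp _ _ _ (fun s => (s - c) / h) hat); last exact: hat_continuous.
by apply: cvgM; [apply: cvgB; [exact: cvg_id|exact: cvg_cst]|exact: cvg_cst].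
Qed.

Lemma bump_derive (c d h t : R) : 
  is_derive t 1 (bump c d h) (hat ((t - c) / h) / h - hat ((t - d) / h) / h).
Proof. exact: is_deriveB (ramp_scale_derive c h t) (ramp_scale_derive d h t). Qed.

Lemma bump_bound (c d h t : R) : `|bump c d h t| <= 1.
Proof.
rewrite /bump; move: (ramp_bound ((t - c) / h)) (ramp_bound ((t - d) / h)).
by move=> /andP[? ?] /andP[? ?]; rewrite ler_norml; apply/andP; split; lra.
Qed.

Lemma bump_out (c d h t : R) : 0 < h -> t <= Num.min c d \/ Num.max c d + h <= t ->
  bump c d h t = 0.
Proof.
move=> h0; rewrite le_min -lerBrDr ge_max => -[/andP[tc td]|/andP[tc td]].
  by rewrite /bump !ramp_le0 ?subrr// pmulr_lle0 ?invr_gt0// subr_le0.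
by rewrite /bump !ramp_ge1 ?subrr// ler_pdivlMr// mul1r; lra.
Qed.

Lemma bump_test (a b c d h : R) : 0 < h -> a < Num.min c d -> Num.max c d + h < b ->
  test_function `]a, b[ (bump c d h).
Proof.
move=> h0 ac db.
have sub : closure [set x | bump c d h x != 0] `<=`
    `[Num.min c d, Num.max c d + h].
  apply: (@subset_trans _ (closure `[Num.min c d, Num.max c d + h])); last first.
    by rewrite -(closure_id _).1//; exact: interval_closed.
  apply: closure_subset => x /= bx; rewrite in_itv/=.
  apply/andP; split; rewrite leNgt; apply: contra bx => /ltW ?.
    by rewrite bump_out//; left.
  by rewrite bump_out//; right.
split.
- by move=> x; apply: (@ex_derive _ _ _ _ _ _ _ (bump_derive c d h x)).
- have -> : derive1 (bump c d h) = fun t => hat ((t - c) / h) / h - hat ((t - d) / h) / h.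
    apply/funext => t; rewrite derive1E; exact: (@derive_val _ _ _ _ _ _ _ (bump_derive c d h t)).
  by move=> x; apply: cvgB; exact: hat_scale_continuous.
- apply: subclosed_compact sub; first exact: closed_closure.
  exact: segment_compact.
- apply: subset_trans sub _ => x /=; rewrite !in_itv/= => /andP[? ?].
  by apply/andP; split; lra.
Qed.

End ramp.

(** * Integrable functions on bounded intervals *)

Section integral_helpers.
Variable R : realType.
Local Notation mu := (@lebesgue_measure R).
Local Notation mR := (measurableTypeR R).
Implicit Types (D B : set mR) (f g K : R -> R).

Lemma ae_mono (P Q : R -> Prop) : (forall x, P x -> Q x) ->
  {ae mu, forall x, P x} -> {ae mu, forall x, Q x}.
Proof. exact: (@filterS _ _ (ae_filter_ringOfSetsType mu)). Qed.

Lemma ae_and (P Q : R -> Prop) : {ae mu, forall x, P x} ->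
  {ae mu, forall x, Q x} -> {ae mu, forall x, P x /\ Q x}.
Proof. exact: (@filterI _ _ (ae_filter_ringOfSetsType mu)). Qed.

Lemma Rintegral_supported (D B : set R) f : B `<=` D -> (forall t, D t -> ~ B t -> f t = 0) ->
  \int[mu]_(t in D) f t = \int[mu]_(t in B) f t.
Proof.
move=> BD f0; rewrite -[in RHS](setIidr BD) Rintegral_mkcondr.
apply: eq_Rintegral => t tD; rewrite patchE; case: ifPn => // /negP tB.
by apply: f0 => [|Bt]; [exact: set_mem|apply: tB; exact: mem_set].
Qed.

Lemma in_L1_mul_bounded D f K C : measurable D -> in_L1 D f ->
  measurable_fun D K -> (forall t, D t -> `|K t| <= C) ->
  in_L1 D (fun t => f t * K t).
Proof.
move=> mD fD mK KC; rewrite /in_L1; under eq_fun do rewrite mulrC EFinM.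
apply: (integrableMr mD mK _ fD).
exists C; split; first exact: num_real.
by move=> y Cy t Dt; exact: le_trans (KC _ Dt) (ltW Cy).
Qed.

Lemma itv_finite (a b : R) : (mu `]a, b[ < +oo)%E.
Proof. by rewrite lebesgue_measure_itv/=; case: ifP => _; rewrite ?EFinN ?ltry. Qed.

Lemma in_L1_cst (a b c : R) : in_L1 `]a, b[ (fun=> c).
Proof.
apply: measurable_bounded_integrable => //; first exact: itv_finite.
by exists `|c|; split; [exact: num_real|move=> y cy t _ /=; exact: ltW].
Qed.

Lemma in_L1_bounded (a b C : R) K : measurable_fun `]a, b[ K ->
  (forall t, `]a, b[%classic t -> `|K t| <= C) -> in_L1 `]a, b[ K.
Proof.
move=> mK KC; apply: measurable_bounded_integrable => //; first exact: itv_finite.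
exists C; split; first exact: num_real.
by move=> y Cy t Dt; exact: le_trans (KC _ Dt) (ltW Cy).
Qed.

Lemma Rintegral_cst_itv (a b c : R) : a <= b -> \int[mu]_(t in `]a, b[) c = c * (b - a).
Proof.
move=> ab; rewrite Rintegral_cst; last exact: measurable_itv.
rewrite /= lebesgue_measure_itv/= lte_fin.
by move: ab; rewrite le_eqVlt => /predU1P[->|->]//; rewrite ltxx subrr.
Qed.

Lemma in_L1_sub D B f : measurable D -> measurable B -> B `<=` D -> in_L1 D f -> in_L1 B f.
Proof. exact: integrableS. Qed.

Lemma in_L1D D f g : measurable D -> in_L1 D f -> in_L1 D g ->
  in_L1 D (fun t => f t + g t).
Proof. by move=> mD fD gD; rewrite /in_L1; under eq_fun do rewrite EFinD; exact: integrableD. Qed.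

Lemma in_L1B D f g : measurable D -> in_L1 D f -> in_L1 D g ->
  in_L1 D (fun t => f t - g t).
Proof. by move=> mD fD gD; rewrite /in_L1; under eq_fun do rewrite EFinB; exact: integrableB. Qed.

Lemma in_L1Z D f c : measurable D -> in_L1 D f -> in_L1 D (fun t => c * f t).
Proof. by move=> mD fD; rewrite /in_L1; under eq_fun do rewrite EFinM; exact: integrableZl. Qed.

Lemma in_L1_norm D f : measurable D -> in_L1 D f -> in_L1 D (fun t => `|f t|).
Proof. by move=> mD; exact: integrable_norm. Qed.

Lemma in_L1_meas D f : in_L1 D f -> measurable_fun D f.
Proof. by move=> /measurable_int h; apply/measurable_EFinP. Qed.

Lemma le_Rintegral_sub D B f : measurable D -> measurable B -> B `<=` D ->
  in_L1 D f -> (forall t, D t -> 0 <= f t) ->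
  \int[mu]_(t in B) f t <= \int[mu]_(t in D) f t.
Proof.
move=> mD mB BD fD f0; rewrite /Rintegral fine_le//.
- exact/integrable_fin_num/(in_L1_sub mD mB BD fD).
- exact: integrable_fin_num.
- apply: ge0_subset_integral => //; exact: measurable_int fD.
Qed.

(** The difference [g - f] is almost everywhere equal to its absolute value,
    and modifying an integrand on a null set does not change its integral. *)
Lemma le_ae_Rintegral D f g : measurable D -> in_L1 D f -> in_L1 D g ->
  {ae mu, forall t, D t -> f t <= g t} ->
  \int[mu]_(t in D) f t <= \int[mu]_(t in D) g t.
Proof.
move=> mD fD gD fg; rewrite -subr_ge0 -RintegralB//.
have -> : \int[mu]_(t in D) (g t - f t) = \int[mu]_(t in D) `|g t - f t|.
  rewrite /Rintegral; congr fine; apply: ae_eq_integral => //.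
  - by apply: measurable_int (in_L1B mD gD fD).
  - by apply: measurable_int (in_L1_norm mD (in_L1B mD gD fD)).
  - by apply: ae_mono fg => t fgt Dt; rewrite ger0_norm// subr_ge0 fgt.
exact: Rintegral_ge0.
Qed.

Lemma eq_ae_Rintegral D f g : measurable D -> in_L1 D f -> in_L1 D g ->
  {ae mu, forall t, D t -> f t = g t} ->
  \int[mu]_(t in D) f t = \int[mu]_(t in D) g t.
Proof.
move=> mD fD gD fg; apply/eqP; rewrite eq_le; apply/andP; split;
  by apply: le_ae_Rintegral => //; apply: ae_mono fg => t fgt Dt; rewrite fgt.
Qed.

Lemma Rintegral_itv_split (a b c : R) f : a <= b <= c -> in_L1 `]a, c[ f ->
  \int[mu]_(t in `]a, c[) f t =
  \int[mu]_(t in `]a, b[) f t + \int[mu]_(t in `]b, c[) f t.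
Proof.
move=> /andP[ab]; rewrite le_eqVlt => /predU1P[<- _|bc fD].
  by rewrite [X in _ + X](_ : _ = 0) ?addr0// set_itv_ge ?Rintegral_set0// bnd_simp ltxx.
have := @Rintegral_itvB _ f (BRight a) (BLeft c) b fD.
rewrite !bnd_simp => /(_ ab bc) <-.
have abD : in_L1 `]a, b[ f.
  apply: (@in_L1_sub `]a, c[) fD; try exact: measurable_itv.
  by apply: subset_itvl; rewrite bnd_simp ltW.
by rewrite (Rintegral_itv_bndo_bndc abD) addrC subrK.
Qed.

End integral_helpers.

(** * Averages against concentrated kernels *)

Section averages.
Variable R : realType.
Local Notation mu := (@lebesgue_measure R).
Local Notation mR := (measurableTypeR R).
Implicit Types (D B : set mR) (f g K : R -> R).

(** A Lebesgue point of [f], in the quantitative form in which it is used: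
    the mean of [f - f x] over small intervals around [x] is small. *)
Definition avg_point D f (x : R) := forall e, 0 < e -> exists2 r0, 0 < r0 &
  forall r, 0 < r < r0 -> `]x - r, x + r[ `<=` D /\
    \int[mu]_(t in `]x - r, x + r[) `|f t - f x| <= e * r.

(** The Lebesgue differentiation theorem, applied to the extension of [f] by
    zero; around a point of the open set [D] the extension is invisible. *)
Lemma ae_avg_point D f : open D -> measurable D -> in_L1 D f ->
  {ae mu, forall x, D x -> avg_point D f x}.
Proof.
move=> oD mD fD.
have gT : mu.-integrable setT (EFin \o (f \_ D)).
  by rewrite -restrict_EFin; exact/(integrable_mkcond _ mD).1.
have leb : {ae mu, forall x, lebesgue_pt (f \_ D) x}.
  exact: lebesgue_differentiation (open_integrable_locally openT gT).
apply: ae_mono leb => x + Dx e e0 => /fine_cvgP[fin cv].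
have /nbhs_ballP[d /= d0 dD] : nbhs x D by exact: open_nbhs_nbhs.
have e20 : 0 < e / 2 by rewrite divr_gt0.
have [r0 /= r00 H] := filterI fin (cvgr_dist_le _ _ cv _ e20).
exists (Num.min d r0); first by rewrite lt_min d0 r00.
move=> r /andP[rpos]; rewrite lt_min => /andP[rd rr0].
have BD : `]x - r, x + r[ `<=` D.
  by rewrite -ball_itv; apply: subset_trans dD; exact: le_ball (ltW rd).
split=> //.
have I0 : (0 <= \int[mu]_(t in ball x r) `|(f \_ D) t - (f \_ D) x|%:E)%E.
  by apply: integral_ge0 => t _; rewrite lee_fin.
have davgE : davg (f \_ D) x r = (((r *+ 2)^-1)%:E *
    \int[mu]_(t in ball x r) `|(f \_ D) t - (f \_ D) x|%:E)%E.
  rewrite /davg /iavg lebesgue_measure_ball ?ltW// inver.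
  by rewrite mulrn_eq0/= gt_eqF.
have [|fn] := H r _ rpos; first by rewrite /= sub0r normrN gtr0_norm.
rewrite sub0r normrN ger0_norm; last first.
  by rewrite fine_ge0// davgE mule_ge0// lee_fin invr_ge0 mulrn_wge0// ltW.
move=> H1; rewrite -lee_fin fineK// davgE lee_pdivrMl in H1; last first.
  by rewrite mulrn_wgt0.
have Ie := H1; rewrite -EFinM in Ie.
have -> : \int[mu]_(t in `]x - r, x + r[) `|f t - f x| =
   fine (\int[mu]_(t in ball x r) `|(f \_ D) t - (f \_ D) x|%:E)%E.
  rewrite ball_itv; apply: eq_Rintegral => t /set_mem tB.
  by rewrite !patchE !mem_set//; exact: BD.
rewrite -lee_fin fineK; last by rewrite ge0_fin_numE// (le_lt_trans Ie) ?ltry.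
by rewrite (le_trans Ie)// lee_fin -mulr_natr; lra.
Qed.

(** Near a Lebesgue point, integrating against a kernel concentrated at scale
    [r] and of height at most [M / r] evaluates the function, up to the mass of
    the kernel: the error is at most [M / r] times the integral of [f - f x]
    over the support, which is [o(r)]. *)
Lemma avg_point_kernel D f x (M e : R) : measurable D -> in_L1 D f ->
  (mu D < +oo)%E ->
  avg_point D f x -> 0 < e -> 0 <= M -> exists2 r0, 0 < r0 & forall r K,
  0 < r < r0 -> measurable_fun setT K -> (forall t, `|K t| <= M / r) ->
  (forall t, ~ `]x - r, x + r[%classic t -> K t = 0) ->
  `|\int[mu]_(t in D) (f t * K t) - f x * \int[mu]_(t in D) K t| <= M * e.
Proof.
move=> mD fD Dfin fx e0 M0; have [r0 r00 H] := fx _ e0.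
exists r0 => // r K rr0 mK KM Ksupp; have [BD Be] := H _ rr0.
have r_gt0 : 0 < r by case/andP: rr0.
have mKD : measurable_fun D K by exact: measurable_funS mK.
have KM' t : D t -> `|K t| <= M / r by move=> _; exact: KM.
have c1 c : in_L1 D (fun=> c).
  apply: measurable_bounded_integrable => //.
  by exists `|c|; split; [exact: num_real|move=> y cy t _ /=; exact: ltW].
have KD : in_L1 D K.
  have := in_L1_mul_bounded mD (c1 1) mKD KM'.
  by under eq_fun do rewrite mul1r.
have fK := in_L1_mul_bounded mD fD mKD KM'.
rewrite -RintegralZl// -RintegralB//; last exact: in_L1Z.
have fxD : in_L1 D (fun t => f t - f x) by exact: in_L1B.
have fxK : in_L1 D (fun t => (f t - f x) * K t) by exact: in_L1_mul_bounded KM'.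
under eq_Rintegral do rewrite -mulrBl.
apply: le_trans (le_normr_Rintegral mD fxK) _.
rewrite (@Rintegral_supported _ _ `]x - r, x + r[); [|exact: BD|]; last first.
  by move=> t _ /Ksupp ->; rewrite mulr0 normr0.
have mB : measurable (`]x - r, x + r[%classic : set mR) by exact: measurable_itv.
apply: (@le_trans _ _ (\int[mu]_(t in `]x - r, x + r[) ((M / r) * `|f t - f x|))).
  apply: le_Rintegral => //.
  - exact/(in_L1_sub mD mB BD)/in_L1_norm.
  - exact/(in_L1_sub mD mB BD)/in_L1Z/in_L1_norm.
  - by move=> t _; rewrite normrM mulrC ler_wpM2r.
rewrite RintegralZl//; last exact/(in_L1_sub mD mB BD)/in_L1_norm.
apply: (@le_trans _ _ (M / r * (e * r))).
  by apply: ler_wpM2l Be; rewrite divr_ge0// ltW.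
by rewrite le_eqVlt; apply/orP; left; apply/eqP; field; rewrite gt_eqF.
Qed.

End averages.

(** * Weak derivatives: uniqueness and oscillation *)

Section weak_derivatives.
Variable R : realType.
Local Notation mu := (@lebesgue_measure R).
Local Notation mR := (measurableTypeR R).
Implicit Types (D B : set mR) (f g u v phi : R -> R) (a b : R).

Lemma in_L2_L1 a b f : in_L2 `]a, b[ f -> in_L1 `]a, b[ f.
Proof.
move=> [mf f2].
have mI : measurable (`]a, b[%classic : set mR) by exact: measurable_itv.
have h1 := in_L1D mI (in_L1_cst a b 1) f2.
apply: (le_integrable mI _ _ h1) => //; first exact/measurable_EFinP.
move=> x _ /=; rewrite lee_fin [leRHS]ger0_norm; last by rewrite addr_ge0 ?sqr_ge0.
by rewrite -[in leRHS]real_normK ?num_real//; have := sqr_ge0 (`|f x| - 1); nra.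
Qed.

Lemma Rintegral_derive1 (a b : R) (f F : R -> R) : a < b -> (forall x : R, is_derive x 1 F (f x)) ->
  continuous f -> \int[mu]_(x in `]a, b[) f x = F b - F a.
Proof.
move=> ab F'f cf.
have cF : continuous F.
  move=> x; apply/differentiable_continuous/derivable1_diffP.
  by apply: (@ex_derive _ _ _ _ _ _ _ (F'f x)).
have -> : \int[mu]_(x in `]a, b[) f x = \int[mu]_(x in `[a, b]) f x.
  have mf (i : interval R) : measurable_fun [set` i] (EFin \o f).
    by apply/measurable_EFinP/measurable_funTS; exact: continuous_measurable_fun.
  rewrite /Rintegral integral_itv_bndo_bndc; last exact: mf.
  by rewrite integral_itv_obnd_cbnd; last exact: mf.
rewrite /Rintegral (@continuous_FTC2 _ f F a b)//.
- exact: continuous_subspaceT.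
- split.
  + by move=> x _; apply: (@ex_derive _ _ _ _ _ _ _ (F'f x)).
  + exact/cvg_at_right_filter/cF.
  + exact/cvg_at_left_filter/cF.
- by move=> x _; rewrite derive1E; exact: (@derive_val _ _ _ _ _ _ _ (F'f x)).
Qed.

(** The complement of the support is open, so outside of it a test function
    vanishes together with its derivative. *)
Lemma test_function_out D phi x : test_function D phi -> ~ D x ->
  phi x = 0 /\ derive1 phi x = 0.
Proof.
move=> [_ _ _ sub] Dx.
have nx : ~ closure [set x | phi x != 0] x by move=> /sub.
split.
  by apply/eqP; apply/negP => phix; apply: nx; apply: subset_closure; exact/negP.
have near0 : \near x, phi x = cst 0 x.
  have : nbhs x (~` closure [set x | phi x != 0]).
    by apply: open_nbhs_nbhs; split => //; exact/closed_openC/closed_closure.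
  apply: filterS => y yn; apply/eqP; apply/negP => phiy; apply: yn.
  by apply: subset_closure; exact/negP.
rewrite derive1E (near_eq_derive _ near0).
exact: derive_cst.
Qed.

Lemma test_function_continuous D phi : test_function D phi -> continuous phi.
Proof.
by move=> [dphi _ _ _] y; apply/differentiable_continuous/derivable1_diffP/dphi.
Qed.

Lemma compact_support_bounded (K : set R) f : compact K -> continuous f ->
  (forall t, ~ K t -> f t = 0) -> exists C, forall t, `|f t| <= C.
Proof.
move=> cK cf f0; have := continuous_compact (continuous_subspaceT cf) cK.
move=> /compact_bounded[M [_ /(_ (`|M| + 1))]].
rewrite (le_lt_trans (ler_norm M)) ?ltrDl// => /(_ isT) HM.
exists (`|M| + 1) => t; have [Kt|/f0 ->] := pselect (K t).
  by apply: HM; exists t.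
by rewrite normr0 addr_ge0.
Qed.

Lemma test_function_bounded D phi : test_function D phi ->
  (exists C, forall t, `|phi t| <= C) /\
  (exists C, forall t, `|derive1 phi t| <= C).
Proof.
move=> phit; have cphi := test_function_continuous phit.
have [dphi cdphi cpt _] := phit.
have phiK : test_function (closure [set x | phi x != 0]) phi by split.
by split; apply: compact_support_bounded cpt _ _ => // t /(test_function_out phiK)[].
Qed.

Lemma test_function_sub D B phi : B `<=` D -> test_function B phi ->
  test_function D phi.
Proof. by move=> BD [? ? ? ?]; split => //; exact: subset_trans BD. Qed.

Lemma in_L2_sub D B f : measurable D -> measurable B -> B `<=` D ->
  in_L2 D f -> in_L2 B f.
Proof.
by move=> mD mB BD [mf f2]; split; [exact: measurable_funS mf|exact: in_L1_sub f2].
Qed.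

(** A test function of the smaller set is a test function of the larger one,
    and both sides of the integration by parts only see its support. *)
Lemma weak_derivative_sub D B u v : measurable D -> measurable B -> B `<=` D ->
  weak_derivative D u v -> weak_derivative B u v.
Proof.
move=> mD mB BD [vD uv]; split; first exact: in_L2_sub vD.
move=> phi phiB; have := uv phi (test_function_sub BD phiB).
have phi0 := test_function_out phiB.
rewrite (Rintegral_supported BD); last by move=> t _ /phi0[_ ->]; rewrite mulr0.
rewrite (@Rintegral_supported _ D B)//.
by move=> t _ /phi0[-> _]; rewrite mulr0.
Qed.


(** At a Lebesgue point [x], plateaus of width comparable to [h] around [x],
    divided by [h], are concentrated kernels whose mass stays at least 2 while
    their integral against [f] vanishes; hence [f x] is smaller than any
    positive number. *)
Lemma zero_of_test_orthogonal a b f : in_L1 `]a, b[ f ->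
  (forall phi, test_function `]a, b[ phi ->
    \int[mu]_(t in `]a, b[) (f t * phi t) = 0) ->
  {ae mu, forall x, `]a, b[%classic x -> f x = 0}.
Proof.
move=> fL1 f0.
have mI : measurable (`]a, b[%classic : set mR) by exact: measurable_itv.
have oI : open (`]a, b[%classic : set R) by exact: interval_open.
have avgf := ae_avg_point oI mI fL1.
apply: ae_mono avgf => x + xI => /(_ xI) xavg.
have /andP[ax xb] : a < x < b by move: xI; rewrite /= in_itv.
apply/eqP; rewrite -normr_le0; apply/ler_addgt0Pr => e e0; rewrite add0r.
have [r0 r00 H] := avg_point_kernel mI fL1 (itv_finite a b) xavg e0 (ler0n _ 2).
pose m := Num.min r0 (Num.min (x - a) (b - x)).
have m0 : 0 < m by rewrite !lt_min r00 !subr_gt0 ax xb.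
pose h := m / 4.
have h0 : 0 < h by rewrite /h; lra.
have /andP[mr0 /andP[mxa mbx]] : (m <= r0) && ((m <= x - a) && (m <= b - x)).
  by rewrite /m !ge_min !lexx !orbT.
(* Equal to 1 on ]x - h, x + h[ and supported in [x - 2 h, x + 2 h]. *)
pose B := bump (x - 2 * h) (x + h) h.
have minE : Num.min (x - 2 * h) (x + h) = x - 2 * h by rewrite min_l//; lra.
have maxE : Num.max (x - 2 * h) (x + h) = x + h by rewrite max_r//; lra.
have Btest : test_function `]a, b[ B.
  by apply: bump_test; rewrite // ?minE ?maxE /h; lra.
have B0 t : 0 <= B t.
  rewrite /B /bump subr_ge0.
  have -> : (t - (x - 2 * h)) / h = (t - (x + h)) / h + 3 by field; rewrite gt_eqF.
  set s := (_ / h); have [s0|s0] := leP s 0.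
    by rewrite (ramp_le0 s0); case/andP: (ramp_bound (s + 3)).
  by rewrite (@ramp_ge1 _ (s + 3)); [case/andP: (ramp_bound s)|lra].
have B1 t : `]x - h, x + h[%classic t -> B t = 1.
  rewrite /= in_itv/= => /andP[t1 t2]; rewrite /B /bump ramp_ge1 ?ramp_le0 ?subr0//.
    by rewrite pmulr_lle0 ?invr_gt0//; lra.
  by rewrite ler_pdivlMr//; lra.
have Bcont : continuous B.
  exact: test_function_continuous Btest.
have mB : measurable_fun setT B by exact: continuous_measurable_fun.
have Bb t : `|B t| <= 1 by exact: bump_bound.
have BI : in_L1 `]a, b[ B.
  by apply: (@in_L1_bounded _ a b 1) => //; exact: measurable_funTS.
have h2 : 0 < 2 * h < r0 by rewrite /h; lra.
have mBh : measurable_fun setT (fun t => B t / h) by exact: measurable_funM.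
have Bhb t : `|B t / h| <= 2 / (2 * h).
  rewrite (_ : (2 / (2 * h)) = h^-1); last by field; rewrite gt_eqF.
  rewrite normrM (ger0_norm (x := h^-1)) ?invr_ge0 ?(ltW h0)//.
  by rewrite ler_piMl ?invr_ge0 ?(ltW h0).
have Bhout t : ~ `]x - 2 * h, x + 2 * h[%classic t -> B t / h = 0.
  move=> tn; rewrite /B bump_out ?mul0r// minE maxE; apply/orP.
  apply/negPn/negP; rewrite negb_or -!ltNge => /andP[? ?]; apply: tn.
  by rewrite /= in_itv/=; apply/andP; split; lra.
have := H (2 * h) (fun t => B t / h) h2 mBh Bhb Bhout.
under eq_Rintegral do rewrite mulrA.
rewrite RintegralZr//; last by apply: (in_L1_mul_bounded mI fL1 _ (fun t _ => Bb t)); exact: measurable_funTS.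
rewrite f0// mul0r sub0r normrN RintegralZr// normrM => Hle.
suff : `|f x| * 2 <= 2 * e by lra.
apply: le_trans Hle; apply: ler_wpM2l => //.
rewrite ger0_norm; last by rewrite divr_ge0 ?(ltW h0)// Rintegral_ge0.
rewrite ler_pdivlMr//.
have mJ : measurable (`]x - h, x + h[%classic : set mR) by exact: measurable_itv.
have JI : `]x - h, x + h[%classic `<=` `]a, b[%classic.
  by apply: subset_itv; rewrite bnd_simp /h; lra.
apply: le_trans (le_Rintegral_sub mI mJ JI BI (fun t _ => B0 t)).
rewrite (_ : \int[mu]_(t in _) B t = \int[mu]_(t in `]x - h, x + h[) 1).
  by rewrite Rintegral_cst_itv; lra.
by apply: eq_Rintegral => t /set_mem; exact: B1.
Qed.

Lemma weak_derivative_unique a b u v w :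
  weak_derivative `]a, b[ u v -> weak_derivative `]a, b[ u w ->
  {ae mu, forall x, `]a, b[%classic x -> v x = w x}.
Proof.
move=> [/in_L2_L1 vI uv] [/in_L2_L1 wI uw].
have mI : measurable (`]a, b[%classic : set mR) by exact: measurable_itv.
have := @zero_of_test_orthogonal a b (fun t => v t - w t) (in_L1B mI vI wI).
move=> H; apply: ae_mono (H _); first by move=> x vw xI; apply/eqP; rewrite -subr_eq0 vw.
move=> phi phit; under eq_Rintegral do rewrite mulrBl.
have phic : continuous phi.
  exact: test_function_continuous phit.
have [[C phiC] _] := test_function_bounded phit.
have mphi : measurable_fun (`]a, b[%classic : set mR) phi.
  by apply: measurable_funTS; exact: continuous_measurable_fun.
rewrite RintegralB//; last 2 first.
- exact: (in_L1_mul_bounded mI vI mphi (fun t _ => phiC t)).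
- exact: (in_L1_mul_bounded mI wI mphi (fun t _ => phiC t)).
by apply/eqP; rewrite subr_eq0 -eqr_opp -uv// -uw.
Qed.

(** A substitute for the fundamental theorem of calculus that avoids
    continuous representatives.  Two tents of mass 1, concentrated at the
    Lebesgue points [x] and [y], evaluate [u x] and [u y]; their difference is
    the derivative of a test function bounded by 1, so integration by parts
    bounds [u x - u y] by the integral of the modulus of the weak derivative. *)
Lemma weak_derivative_osc a b u v x y : in_L1 `]a, b[ u ->
  weak_derivative `]a, b[ u v ->
  `]a, b[%classic x -> avg_point `]a, b[ u x ->
  `]a, b[%classic y -> avg_point `]a, b[ u y ->
  `|u x - u y| <= \int[mu]_(t in `]a, b[) `|v t|.
Proof.
move=> uI [/in_L2_L1 vI uv] xI xavg yI yavg.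
have mI : measurable (`]a, b[%classic : set mR) by exact: measurable_itv.
have /andP[ax xb] : a < x < b by move: xI; rewrite /= in_itv.
have /andP[ay yb] : a < y < b by move: yI; rewrite /= in_itv.
apply/ler_addgt0Pr => e e0; have e4 : 0 < e / 4 by lra.
have tri (p q r s t : R) : `|p - q| <= 2 * (e / 4) ->
    `|r - s| <= 2 * (e / 4) -> `|p - r| <= t -> `|q - s| <= t + e.
  rewrite !ler_norml => /andP[? ?] /andP[? ?] /andP[? ?].
  by apply/andP; split; lra.
have [rx rx0 Hx] := avg_point_kernel mI uI (itv_finite a b) xavg e4 (ler0n _ 2).
have [ry ry0 Hy] := avg_point_kernel mI uI (itv_finite a b) yavg e4 (ler0n _ 2).
pose m := Num.min (Num.min rx ry) (Num.min (b - x) (b - y)).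
have m0 : 0 < m by rewrite !lt_min rx0 ry0 !subr_gt0 xb yb.
pose h := m / 2.
have h0 : 0 < h by rewrite /h; lra.
have /and4P[mx my mbx mby] : [&& m <= rx, m <= ry, m <= b - x & m <= b - y].
  by rewrite /m !ge_min !lexx !orbT.
(* The tent of mass 1 supported in [z, z + h]. *)
pose K z t := hat ((t - z) / h) / h.
have Kb z t : `|K z t| <= 2 / h.
  have /andP[k0 k2] := hat_bound ((t - z) / h).
  rewrite /K normrM (ger0_norm k0) (ger0_norm (x := h^-1)) ?invr_ge0 ?(ltW h0)//.
  by apply: ler_wpM2r => //; rewrite invr_ge0 ltW.
have Kout z t : ~ `]z - h, z + h[%classic t -> K z t = 0.
  move=> tn; rewrite /K hat_out ?mul0r// pmulr_lle0 ?invr_gt0// ler_pdivlMr// mul1r.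
  apply/orP/negPn/negP; rewrite negb_or -!ltNge => /andP[? ?]; apply: tn.
  by rewrite /= in_itv/=; apply/andP; split; lra.
have cK z : continuous (K z) by exact: hat_scale_continuous.
have mK z : measurable_fun setT (K z) by exact: continuous_measurable_fun.
have mKI z : measurable_fun (`]a, b[%classic : set mR) (K z).
  by apply: measurable_funTS; exact: mK.
have KI z : in_L1 `]a, b[ (K z).
  by apply: (@in_L1_bounded _ a b (2 / h)) => //; exact: mKI.
have uK z : in_L1 `]a, b[ (fun t => u t * K z t).
  exact: (in_L1_mul_bounded mI uI (mKI z) (fun t _ => Kb z t)).
have K1 z : a < z -> h <= b - z -> \int[mu]_(t in `]a, b[) K z t = 1.
  move=> az hz.
  rewrite (Rintegral_derive1 (lt_trans ax xb) (ramp_scale_derive z h) (cK z)).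
  rewrite ramp_ge1 ?ramp_le0 ?subr0// ?ler_pdivlMr// ?pmulr_lle0 ?invr_gt0//; lra.
have hx : 0 < h < rx by rewrite h0/=; rewrite /h; lra.
have hy : 0 < h < ry by rewrite h0/=; rewrite /h; lra.
have := Hx h (K x) hx (mK x) (Kb x) (Kout x).
have := Hy h (K y) hy (mK y) (Kb y) (Kout y).
rewrite !K1 ?mulr1 => //; try (rewrite /h; lra).
set Iy := Rintegral _ _ _; set Ix := Rintegral _ _ _ => yle xle.
pose phi := bump x y h.
have phit : test_function `]a, b[ phi.
  apply: bump_test => //; first by rewrite lt_min ax ay.
  by rewrite -ltrBrDr gt_max /h; apply/andP; split; lra.
have dphi : derive1 phi = fun t => K x t - K y t.
  by apply/funext => t; rewrite derive1E; exact: (@derive_val _ _ _ _ _ _ _ (bump_derive x y h t)).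
have phic : continuous phi.
  exact: test_function_continuous phit.
have mphi : measurable_fun (`]a, b[%classic : set mR) phi.
  by apply: measurable_funTS; exact: continuous_measurable_fun.
have vphi : in_L1 `]a, b[ (fun t => v t * phi t).
  by apply: (in_L1_mul_bounded mI vI mphi (fun t _ => bump_bound x y h t)).
have := uv phi phit; rewrite dphi.
under eq_Rintegral do rewrite mulrBr.
rewrite (RintegralB mI (uK x) (uK y)) -/Ix -/Iy => IxIy.
have : `|Ix - Iy| <= \int[mu]_(t in `]a, b[) `|v t|.
  rewrite IxIy normrN; apply: le_trans (le_normr_Rintegral mI vphi) _.
  apply: le_Rintegral => //; [exact: in_L1_norm|exact: in_L1_norm|].
  by move=> t _; rewrite normrM ler_piMr// bump_bound.
exact: tri xle yle.
Qed.

End weak_derivatives.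

(** * The interpolation inequality on a partition *)

Section sobolev_restriction.
Variable R : realType.
Local Notation mu := (@lebesgue_measure R).
Local Notation mR := (measurableTypeR R).
Implicit Types (D B : set mR) (f g u v phi : R -> R) (a b : R).

Lemma wderivP D u : W12 D u -> weak_derivative D u (wderiv D u).
Proof. by move=> [_ uv]; exact: (xgetPex _ uv). Qed.

Lemma weak_derivative_ae a b u v w : in_L1 `]a, b[ u -> in_L1 `]a, b[ v ->
  {ae mu, forall x, `]a, b[%classic x -> u x = v x} ->
  weak_derivative `]a, b[ u w -> weak_derivative `]a, b[ v w.
Proof.
move=> uI vI uv [wI uw]; split => // phi phit; rewrite -uw//.
have mI : measurable (`]a, b[%classic : set mR) by exact: measurable_itv.
have [_ [C phiC]] := test_function_bounded phit.
have mphi : measurable_fun (`]a, b[%classic : set mR) (derive1 phi).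
  by apply: measurable_funTS; apply: continuous_measurable_fun; case: phit.
apply: eq_ae_Rintegral => //.
- exact: (in_L1_mul_bounded mI vI mphi (fun t _ => phiC t)).
- exact: (in_L1_mul_bounded mI uI mphi (fun t _ => phiC t)).
- by apply: ae_mono uv => x uvx xI; rewrite uvx.
Qed.

(** The representatives chosen by [wderiv] on the two intervals have no reason
    to agree pointwise; uniqueness of weak derivatives makes them agree almost
    everywhere, which is what integrals over the smaller interval see. *)
Lemma W22_sub a b c d u : a <= c -> d <= b -> W22 `]a, b[ u ->
  [/\ W22 `]c, d[ u,
    {ae mu, forall x, `]c, d[%classic x -> wderiv `]a, b[ u x = wderiv `]c, d[ u x} &
    {ae mu, forall x, `]c, d[%classic x ->
      wderiv `]a, b[ (wderiv `]a, b[ u) x = wderiv `]c, d[ (wderiv `]c, d[ u) x}].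
Proof.
move=> ac db [uW vW].
have mI : measurable (`]a, b[%classic : set mR) by exact: measurable_itv.
have mJ : measurable (`]c, d[%classic : set mR) by exact: measurable_itv.
have JI : `]c, d[%classic `<=` `]a, b[%classic.
  by apply: subset_itv; rewrite bnd_simp.
have uvI := wderivP uW; have vwI := wderivP vW.
have uvJ' := weak_derivative_sub mI mJ JI uvI.
have vwJ' := weak_derivative_sub mI mJ JI vwI.
have uWJ : W12 `]c, d[ u.
  by split; [exact: in_L2_sub (uW.1)|exists (wderiv `]a, b[ u)].
have uvJ := wderivP uWJ.
have vv := weak_derivative_unique uvJ' uvJ.
have vJ2 : in_L2 `]c, d[ (wderiv `]c, d[ u) by case: uvJ.
have vI2 : in_L2 `]c, d[ (wderiv `]a, b[ u) by case: uvJ'.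
have vwJ2 := weak_derivative_ae (in_L2_L1 vI2) (in_L2_L1 vJ2) vv vwJ'.
have vWJ : W12 `]c, d[ (wderiv `]c, d[ u).
  by split => //; exists (wderiv `]a, b[ (wderiv `]a, b[ u)).
by split => //; exact: (weak_derivative_unique vwJ2 (wderivP vWJ)).
Qed.

Lemma EFin_Rintegral D f : measurable D -> in_L1 D f ->
  (\int[mu]_(x in D) (f x)%:E = (\int[mu]_(x in D) f x)%R%:E)%E.
Proof. by move=> mD fD; rewrite /Rintegral fineK//; exact: integrable_fin_num. Qed.

(** The interpolation inequality on a subinterval, with the derivatives taken
    on the whole interval so that the inequalities on adjacent cells add up. *)
Lemma interpolation_sub (W : R -> R) (k0 : R) a b c d u :
  nonlinear_interpolation W k0 -> a <= c -> c < d -> d <= b ->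
  W22 `]a, b[ u -> in_L1 `]a, b[ (W \o u) ->
  k0 * \int[mu]_(x in `]c, d[) (wderiv `]a, b[ u x ^+ 2) <=
  (\int[mu]_(x in `]c, d[) W (u x)) / (d - c) ^+ 2 +
  (d - c) ^+ 2 * \int[mu]_(x in `]c, d[) (wderiv `]a, b[ (wderiv `]a, b[ u) x ^+ 2).
Proof.
move=> interp ac cd db uW WI.
have mI : measurable (`]a, b[%classic : set mR) by exact: measurable_itv.
have mJ : measurable (`]c, d[%classic : set mR) by exact: measurable_itv.
have JI : `]c, d[%classic `<=` `]a, b[%classic.
  by apply: subset_itv; rewrite bnd_simp.
have [uWJ vv ww] := W22_sub ac db uW.
have [[_ v2] _] := wderivP uW.1; have [[_ w2] _] := wderivP uW.2.
have [[_ vJ2] _] := wderivP uWJ.1; have [[_ wJ2] _] := wderivP uWJ.2.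
have WJ := in_L1_sub mI mJ JI WI.
have := interp c d u cd uWJ.
rewrite (EFin_Rintegral mJ vJ2) (EFin_Rintegral mJ wJ2) (EFin_Rintegral mJ WJ).
rewrite -!EFinM -EFinD lee_fin div1r mulrC [in leRHS]mulrC mulrC.
rewrite -(@eq_ae_Rintegral _ _ _ _ mJ (in_L1_sub mI mJ JI v2) vJ2); last first.
  by apply: ae_mono vv => x vvx xJ; rewrite vvx.
rewrite -(@eq_ae_Rintegral _ _ _ _ mJ (in_L1_sub mI mJ JI w2) wJ2)//.
by apply: ae_mono ww => x wwx xJ; rewrite wwx.
Qed.

Lemma Rintegral_cells (a l : R) (N : nat) f : 0 <= l ->
  in_L1 `]a, a + l * N%:R[ f ->
  \int[mu]_(x in `]a, a + l * N%:R[) f x =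
  \sum_(i < N) \int[mu]_(x in `]a + l * i%:R, a + l * i.+1%:R[) f x.
Proof.
move=> l0; elim: N => [|N IH] fI.
  by rewrite big_ord0 mulr0 addr0 set_itv_ge ?Rintegral_set0// bnd_simp ltxx.
have le1 : a <= a + l * N%:R by rewrite lerDl mulr_ge0.
have le2 : a + l * N%:R <= a + l * N.+1%:R.
  by rewrite lerD2l ler_wpM2l// ler_nat.
rewrite big_ord_recr/= -IH; first by apply: Rintegral_itv_split; rewrite ?le1.
apply: in_L1_sub fI; try exact: measurable_itv.
by apply: subset_itvl; rewrite bnd_simp.
Qed.

Lemma interpolation_cells (W : R -> R) (k0 : R) a b u (N : nat) (l : R) :
  nonlinear_interpolation W k0 -> a < b -> (0 < N)%N ->
  W22 `]a, b[ u -> in_L1 `]a, b[ (W \o u) ->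
  l = (b - a) / N%:R ->
  k0 * \int[mu]_(x in `]a, b[) (wderiv `]a, b[ u x ^+ 2) <=
  (\int[mu]_(x in `]a, b[) W (u x)) / l ^+ 2 +
  l ^+ 2 * \int[mu]_(x in `]a, b[) (wderiv `]a, b[ (wderiv `]a, b[ u) x ^+ 2).
Proof.
move=> interp ab N0 uW WI lE.
have l0 : 0 < l by rewrite lE divr_gt0 ?subr_gt0 ?ltr0n.
have bE : b = a + l * N%:R by rewrite lE divfK ?pnatr_eq0 -?lt0n// addrC subrK.
have [[_ v2] _] := wderivP uW.1; have [[_ w2] _] := wderivP uW.2.
have cells f : in_L1 `]a, b[ f -> \int[mu]_(x in `]a, b[) f x =
    \sum_(i < N) \int[mu]_(x in `]a + l * i%:R, a + l * i.+1%:R[) f x.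
  by move=> fI; rewrite [in LHS]bE Rintegral_cells ?ltW// -bE.
rewrite (cells _ v2) (cells _ w2) (cells _ WI).
rewrite !mulr_sumr mulr_suml -big_split/=.
apply: ler_sum => i _.
have dl : a + l * i.+1%:R - (a + l * i%:R) = l by rewrite -natr1; ring.
rewrite -[X in _ / X ^+ 2 + _]dl -[X in _ + X ^+ 2 * _]dl.
apply: interpolation_sub => //.
- by rewrite lerDl mulr_ge0// ltW.
- by rewrite ltrD2l ltr_pM2l// ltr_nat.
- by rewrite [leRHS]bE lerD2l ler_pM2l// ler_nat.
Qed.

End sobolev_restriction.

(** * Coercivity of the energy *)

Section energy_bounds.
Variable R : realType.
Local Notation mu := (@lebesgue_measure R).
Local Notation mR := (measurableTypeR R).
Implicit Types (D B : set mR) (f g u v phi : R -> R) (a b : R).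

(** The negative part of [g + f] is dominated by [`|f|], so a finite upper bound
    for the integral of [g + f] forces its positive part to be integrable, and
    [g] is at most this positive part plus [`|f|]. *)
Lemma in_L1_of_integral_le D f g C : measurable D -> measurable_fun D g ->
  (forall x, D x -> 0 <= g x) -> in_L1 D f ->
  (\int[mu]_(x in D) (g x + f x)%:E <= C%:E)%E -> in_L1 D g.
Proof.
move=> mD mg g0 fI le_C.
pose F x := (g x + f x)%:E.
have mf : measurable_fun D f := in_L1_meas fI.
have mF : measurable_fun D F.
  by apply/measurable_EFinP; exact: measurable_funD.
have nf : in_L1 D (fun x => `|f x|) by exact: in_L1_norm.
have mnf : measurable_fun D (fun x => `|f x|) := in_L1_meas nf.
have Fneg : (\int[mu]_(x in D) F^\- x < +oo)%E.
  apply: le_lt_trans (integrable_lty mD nf).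
  apply: ge0_le_integral => //.
  - exact: measurable_funeneg.
  - exact/measurable_EFinP.
  - move=> x Dx; rewrite funenegE /F -EFinN -EFin_max lee_fin ge_max normr_ge0 andbT.
    have := ler_norm (- f x); rewrite normrN; have := g0 _ Dx; lra.
have Fneg0 : (0 <= \int[mu]_(x in D) F^\- x)%E by exact: integral_ge0.
have Fpos : (\int[mu]_(x in D) F^\+ x < +oo)%E.
  rewrite ltey; apply/negP => /eqP Fy; move: le_C.
  rewrite -/F integralE Fy.
  have -> : (\int[mu]_(x in D) F^\- x = (fine (\int[mu]_(x in D) F^\- x))%:E)%E.
    by rewrite fineK// ge0_fin_numE.
  by rewrite -EFinN addye// leye_eq.
apply/integrableP; split; first exact/measurable_EFinP.
apply: (@le_lt_trans _ _ (\int[mu]_(x in D) (F^\+ x + `|f x|%:E))%E); last first.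
  rewrite ge0_integralD//; first by rewrite lte_add_pinfty//; exact: integrable_lty.
  - exact: measurable_funepos.
  - exact/measurable_EFinP.
apply: ge0_le_integral => //.
- by apply: measurableT_comp => //; exact/measurable_EFinP.
- by apply: emeasurable_funD; [exact: measurable_funepos|exact/measurable_EFinP].
- move=> x Dx; rewrite funeposE /F -EFin_max -EFinD lee_fin ger0_norm ?g0//.
  apply: (@le_trans _ _ (g x + f x + `|f x|)).
    by have := ler_norm (- f x); rewrite normrN; lra.
  by rewrite lerD2r le_max lexx.
Qed.

(** Integrability of [W \o u] comes from the finiteness of the energy, the
    other two terms being integrable because [u] is in [W22]. *)
Lemma energy_le_split (W : R -> R) (k eps C : R) a b u :
  continuous W -> (forall s, 0 <= W s) -> 0 < eps -> W22 `]a, b[ u ->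
  (energy W `]a, b[ k eps u <= C%:E)%E ->
  in_L1 `]a, b[ (W \o u) /\
  (\int[mu]_(x in `]a, b[) W (u x)) / eps
  - k * eps * \int[mu]_(x in `]a, b[) (wderiv `]a, b[ u x ^+ 2)
  + eps ^+ 3 * \int[mu]_(x in `]a, b[) (wderiv `]a, b[ (wderiv `]a, b[ u) x ^+ 2)
  <= C.
Proof.
move=> cW W0 e0 uW; rewrite /energy; case: pselect => //= ?.
have mI : measurable (`]a, b[%classic : set mR) by exact: measurable_itv.
have [[_ v2] _] := wderivP uW.1; have [[_ w2] _] := wderivP uW.2.
set v := wderiv `]a, b[ u; set w := wderiv `]a, b[ v.
rewrite -/v in v2; rewrite -/v -/w in w2.
have [[mu_u _] _] := uW.1.
have kv := in_L1Z (- (k * eps)) mI v2; have ew := in_L1Z (eps ^+ 3) mI w2.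
have kvew := in_L1D mI kv ew.
have mWu : measurable_fun (`]a, b[%classic : set mR) (W \o u).
  by apply: measurableT_comp => //; exact: continuous_measurable_fun.
have mWe : measurable_fun (`]a, b[%classic : set mR) (fun x => eps^-1 * W (u x)).
  exact: measurable_funM.
have -> : (\int[mu]_(x in `]a, b[)
    (W (u x) / eps - k * eps * v x ^+ 2 + eps ^+ 3 * w x ^+ 2)%:E =
  \int[mu]_(x in `]a, b[) (eps^-1 * W (u x) + (- (k * eps) * v x ^+ 2 + eps ^+ 3 * w x ^+ 2))%:E)%E.
  by apply: eq_integral => x _; congr EFin; ring.
move=> leC.
have WeI : in_L1 `]a, b[ (fun x => eps^-1 * W (u x)).
  by apply: (in_L1_of_integral_le mI mWe _ kvew leC) => x _; rewrite mulr_ge0// invr_ge0 ltW.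
have WI : in_L1 `]a, b[ (W \o u).
  have -> : W \o u = fun x => eps * (eps^-1 * W (u x)).
    by apply/funext => x /=; rewrite mulVKf// gt_eqF.
  exact: in_L1Z.
split=> //; move: leC.
rewrite (EFin_Rintegral mI (in_L1D mI WeI kvew)) lee_fin.
rewrite (RintegralD mI WeI kvew) (RintegralD mI kv ew).
rewrite (RintegralZl _ mI WI) (RintegralZl _ mI v2) (RintegralZl _ mI w2).
by rewrite mulrC mulNr addrA.
Qed.

(** Here [A], [B], [D] stand for the integrals of [W (u)], [u'^2] and [u''^2], and
    [l] for the length of the cells.  As [l] is close to [eps], the
    interpolation inequality bounds [k * eps * B] by a fraction
    [(k + k0) / (2 * k0) < 1] of [A / eps + eps ^+ 3 * D], so the negative term of
    the energy is absorbed by the two positive ones. *)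
Lemma energy_coercive (k k0 C eps l A B D : R) : 0 < k -> k < k0 -> 0 <= C ->
  0 < l -> l <= eps -> eps ^+ 2 * k <= l ^+ 2 * ((k + k0) / 2) ->
  0 <= A -> 0 <= B -> 0 <= D ->
  k0 * B <= A / l ^+ 2 + l ^+ 2 * D ->
  A / eps - k * eps * B + eps ^+ 3 * D <= C ->
  A / eps + eps * B <= (1 + k^-1) * (C * (2 * k0 / (k0 - k))).
Proof.
move=> k0' kk0 C0 l0 le_eps qle A0 B0 D0 interp en.
have e0 : 0 < eps by exact: lt_le_trans le_eps.
set m := (k + k0) / 2 in qle.
have km : k < m by rewrite /m; lra.
have mk0 : m < k0 by rewrite /m; lra.
pose S := A / eps + eps ^+ 3 * D.
have S0 : 0 <= S by rewrite addr_ge0 ?divr_ge0 ?mulr_ge0 ?exprn_ge0// ltW.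
have h1 : k * eps * (A / l ^+ 2) <= m * (A / eps).
  rewrite -(ler_pM2r (x := l ^+ 2 * eps)) ?mulr_gt0 ?exprn_gt0//.
  have -> : k * eps * (A / l ^+ 2) * (l ^+ 2 * eps) = (eps ^+ 2 * k) * A.
    by field; rewrite gt_eqF.
  have -> : m * (A / eps) * (l ^+ 2 * eps) = (l ^+ 2 * m) * A.
    by field; rewrite gt_eqF.
  exact: ler_wpM2r.
have h2 : k * eps * (l ^+ 2 * D) <= m * (eps ^+ 3 * D).
  apply: (@le_trans _ _ (k * (eps ^+ 3 * D))).
    have -> : eps ^+ 3 * D = eps * (eps ^+ 2 * D) by ring.
    rewrite -mulrA ler_pM2l// ler_pM2l//; apply: ler_wpM2r => //.
    by rewrite lerXn2r// ?nnegrE ltW.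
  by apply: ler_wpM2r; [rewrite mulr_ge0// exprn_ge0// ltW|rewrite ltW].
have h3 : k0 * (k * eps * B) <= m * S.
  rewrite /S mulrDr; apply: le_trans (lerD h1 h2); rewrite -mulrDr mulrCA.
  by apply: ler_wpM2l interp; rewrite mulr_ge0 ?ltW.
have h4 : S - k * eps * B <= C by rewrite /S; lra.
have k0_gt0 : 0 < k0 by lra.
have S_le : S <= C * (2 * k0 / (k0 - k)).
  rewrite -[leLHS]mulr1 -[X in S * X](@mulfV _ (k0 - k)) ?subr_eq0 ?gt_eqF//.
  rewrite !mulrA ler_pM2r ?invr_gt0 ?subr_gt0//.
  have -> : k0 - k = 2 * (k0 - m) by rewrite /m; field.
  by have := ler_wpM2l (ltW k0_gt0) h4; rewrite mulrBr; lra.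
apply: (@le_trans _ _ ((1 + k^-1) * S)); last first.
  by apply: ler_wpM2l S_le; rewrite addr_ge0 ?invr_ge0 ?ltW.
rewrite mulrDl mul1r lerD//.
  by rewrite /S lerDl; apply: mulr_ge0 => //; apply/exprn_ge0/ltW.
rewrite -(ler_pM2l k0') -(ler_pM2l k0_gt0).
have -> : k0 * (k * (k^-1 * S)) = k0 * S by field; rewrite gt_eqF.
have -> : k0 * (k * (eps * B)) = k0 * (k * eps * B) by ring.
by apply: le_trans h3 _; apply: ler_wpM2r => //; exact: ltW.
Qed.

End energy_bounds.

(** * Cells of low energy *)

Section sign.
Variable R : realType.
Local Notation mu := (@lebesgue_measure R).
Local Notation mR := (measurableTypeR R).
Implicit Types (D B : set mR) (f g u v phi : R -> R) (a b c d : R).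

Lemma double_well_coercive (W : R -> R) : double_well W ->
  exists2 w, 0 < w & forall s, w * (`|s| - 1) ^+ 2 <= W s.
Proof.
move=> [_ _ _ [w [w0 Wp Wn]]]; exists w => // s.
have [s0|s0] := leP 0 s; first by rewrite ger0_norm// Wp.
by rewrite ltr0_norm// -opprD sqrrN Wn// ltW.
Qed.

Definition pos_ae D u := {ae mu, forall x, D x -> 0 < u x}.
Definition neg_ae D u := {ae mu, forall x, D x -> u x < 0}.

Lemma not_pos_neg_ae c d u : c < d -> pos_ae `]c, d[ u -> ~ neg_ae `]c, d[ u.
Proof.
move=> cd up un; have : {ae mu, forall x, ~ `]c, d[%classic x}.
  apply: ae_mono (ae_and up un) => x [xp xn] xI.
  by have := lt_trans (xp xI) (xn xI); rewrite ltxx.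
move=> [Z [mZ Z0 IZ]].
have : (mu `]c, d[ <= 0)%E.
  rewrite -Z0; apply: le_measure; rewrite ?inE//.
  by apply: subset_trans IZ => x xI /=; apply.
by rewrite lebesgue_measure_itv/= lte_fin cd -EFinD lee_fin subr_le0 leNgt cd.
Qed.

Definition cell_energy (W : R -> R) (eps : R) u v c d : R :=
  (\int[mu]_(x in `]c, d[) W (u x)) / eps +
  eps * \int[mu]_(x in `]c, d[) (v x ^+ 2).

(** On an interval of length comparable to [eps], a low energy makes the
    integral of [`|v|] less than [1/2].  If [u] were not of constant sign, there
    would be Lebesgue points where [u <= 0] and where [0 <= u]; then [`|u| <= 1/2]
    almost everywhere, and the potential term alone would be too large. *)
Lemma low_energy_sign (W : R -> R) (w eps : R) c d u v :
  0 < w -> (forall s, w * (`|s| - 1) ^+ 2 <= W s) -> 0 < eps ->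
  eps / 2 <= d - c -> d - c <= 2 * eps ->
  in_L1 `]c, d[ u -> in_L1 `]c, d[ (W \o u) -> weak_derivative `]c, d[ u v ->
  cell_energy W eps u v c d < Num.min (w / 8) (16^-1) ->
  pos_ae `]c, d[ u \/ neg_ae `]c, d[ u.
Proof.
move=> w0 Ww e0 len1 len2 uI WI uv; rewrite lt_min /cell_energy => /andP[Ew E16].
have mJ : measurable (`]c, d[%classic : set mR) by exact: measurable_itv.
have cd : c < d by lra.
have v2I : in_L1 `]c, d[ (fun x => v x ^+ 2) by case: uv => -[].
have vI : in_L1 `]c, d[ v by apply: in_L2_L1; case: uv.
have W0 s : 0 <= W s by apply: le_trans (Ww s); rewrite mulr_ge0 ?sqr_ge0// ltW.
set A := Rintegral _ _ _ in Ew E16; set B := Rintegral _ _ _ in Ew E16.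
have A0 : 0 <= A / eps by apply: divr_ge0; [exact: Rintegral_ge0|exact: ltW].
have B0 : 0 <= eps * B.
  apply: mulr_ge0; first exact: ltW.
  by apply: Rintegral_ge0 => x _; exact: sqr_ge0.
(* Young's inequality with weight 8 eps gives 1/8 from the length of the
   interval and at most 4/16 from the energy. *)
have V : \int[mu]_(x in `]c, d[) `|v x| <= 2^-1.
  have i1 : in_L1 `]c, d[ (fun x => 4 * eps * v x ^+ 2) by exact: in_L1Z.
  have i0 : in_L1 `]c, d[ (fun=> (16 * eps)^-1) by exact: in_L1_cst.
  apply: (@le_trans _ _ (\int[mu]_(x in `]c, d[) ((16 * eps)^-1 + 4 * eps * v x ^+ 2))).
    apply: le_Rintegral => //; [exact: in_L1_norm|exact: in_L1D|].
    move=> x _; rewrite -(ler_pM2l (x := 16 * eps)) ?mulr_gt0// mulrDr mulfV ?gt_eqF ?mulr_gt0//.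
    rewrite -[in leRHS]real_normK ?num_real//.
    by have := sqr_ge0 (8 * eps * `|v x| - 1); nra.
  rewrite RintegralD// Rintegral_cst_itv ?ltW// RintegralZl// -/B.
  have : (16 * eps)^-1 * (d - c) <= 8^-1.
    by rewrite mulrC ler_pdivrMr ?mulr_gt0//; lra.
  lra.
have [|npos] := pselect (pos_ae `]c, d[ u); first by left.
have [|nneg] := pselect (neg_ae `]c, d[ u); first by right.
exfalso.
have oJ : open (`]c, d[%classic : set R) by exact: interval_open.
have avg := ae_avg_point oJ mJ uI.
have [x [xJ xavg ux]] : exists x, [/\ `]c, d[%classic x, avg_point `]c, d[ u x & u x <= 0].
  apply: contrapT => nx; apply: npos; apply: ae_mono avg => x xavg xJ.
  by rewrite ltNge; apply/negP => ux; apply: nx; exists x; split => //; exact: xavg.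
have [y [yJ yavg uy]] : exists x, [/\ `]c, d[%classic x, avg_point `]c, d[ u x & 0 <= u x].
  apply: contrapT => nx; apply: nneg; apply: ae_mono avg => z zavg zJ.
  by rewrite ltNge; apply/negP => uz; apply: nx; exists z; split => //; exact: zavg.
have Wlow : {ae mu, forall z, `]c, d[%classic z -> w / 4 <= W (u z)}.
  apply: ae_mono avg => z zavg zJ.
  have := le_trans (weak_derivative_osc uI uv xJ xavg zJ (zavg zJ)) V.
  have := le_trans (weak_derivative_osc uI uv yJ yavg zJ (zavg zJ)) V.
  rewrite !ler_norml => /andP[? ?] /andP[? ?].
  have uz : `|u z| <= 2^-1 by rewrite ler_norml; apply/andP; split; lra.
  apply: le_trans (Ww (u z)); rewrite ler_pM2l//.
  by have := normr_ge0 (u z); nra.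
have : w / 4 * (d - c) <= A.
  have := le_ae_Rintegral mJ (in_L1_cst c d (w / 4)) WI Wlow.
  by rewrite Rintegral_cst_itv// ltW.
move=> wA.
have wA' : w / 4 * (eps / 2) <= A.
  by apply: le_trans wA; rewrite ler_pM2l// divr_gt0.
have : w / 8 <= A / eps by rewrite ler_pdivlMr//; lra.
by lra.
Qed.

End sign.

(** * Step functions with values 1 and -1 *)

Section steps.
Variable R : realType.
Local Notation mu := (@lebesgue_measure R).
Local Notation mR := (measurableTypeR R).
Implicit Types (t x : R) (ts : seq R).

Definition flip t x : R := if t <= x then 1 else -1.

Definition step ts x : R := \prod_(t <- ts) flip t x.

Lemma norm_flip t x : `|flip t x| = 1.
Proof. by rewrite /flip; case: ifP => _; rewrite ?normrN normr1. Qed.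

Lemma norm_step ts x : `|step ts x| = 1.
Proof.
rewrite /step; elim: ts => [|t ts IH]; first by rewrite big_nil normr1.
by rewrite big_cons normrM norm_flip IH mulr1.
Qed.

Lemma measurable_flip t : measurable_fun setT (flip t).
Proof.
rewrite /flip; apply: measurable_fun_ifT => //.
by apply: measurable_fun_ler => //; exact: measurable_id.
Qed.

Lemma measurable_step ts : measurable_fun setT (step ts).
Proof.
rewrite /step; elim: ts => [|t ts IH].
  by under eq_fun do rewrite big_nil; exact: measurable_cst.
under eq_fun do rewrite big_cons.
by apply: measurable_funM => //; exact: measurable_flip.
Qed.

(** A jump is placed at the right end of cell [i] exactly when
    [sg i * sg i.+1 = -1].  On cell [j] the jumps at its left contribute 1, and
    those at its right the telescoping product
    [\prod_(j <= i < N) sg i * sg i.+1 = sg j * sg N]. *)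
Lemma step_cell (a l : R) (N : nat) (sg : nat -> R) (j : nat) x :
  0 <= l -> (forall i, sg i = 1 \/ sg i = -1) -> sg N = 1 -> (j < N)%N ->
  a + l * j%:R < x < a + l * j.+1%:R ->
  step [seq a + l * i.+1%:R | i <- iota 0 N & sg i != sg i.+1] x = sg j.
Proof.
move=> l0 sg1 sgN jN /andP[jx xj].
have sgsq i : sg i * sg i = 1 by case: (sg1 i) => ->; rewrite ?mulrNN mulr1.
have sgE i : (if sg i != sg i.+1 then -1 else 1) = sg i * sg i.+1.
  have n11 : (-1 == 1 :> R) = false by apply/negP => /eqP ?; lra.
  have n11' : (1 == -1 :> R) = false by apply/negP => /eqP ?; lra.
  by case: (sg1 i) => ->; case: (sg1 i.+1) => ->; rewrite ?eqxx ?n11 ?n11'/= ?mulrNN ?mulr1 ?mul1r.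
rewrite /step big_map big_filter big_mkcond/=.
rewrite (_ : iota 0 N = index_iota 0 N); last by rewrite /index_iota subn0.
rewrite (big_cat_nat (leq0n j) (ltnW jN))/=.
rewrite big_nat big1 ?mul1r; last first.
  move=> i /andP[_ ij]; case: ifP => // _; rewrite /flip ifT//.
  by apply/ltW/(le_lt_trans _ jx); rewrite lerD2l ler_wpM2l// ler_nat.
rewrite (_ : \prod_(_ <= _ < _) _ = \prod_(j <= i < N) (sg i * sg i.+1)); last first.
  apply: eq_big_nat => i /andP[ji _]; rewrite -sgE; case: ifP => // _.
  rewrite /flip ifF//; apply/negbTE; rewrite -ltNge.
  by apply: (lt_le_trans xj); rewrite lerD2l ler_wpM2l// ler_nat.
have -> : sg j = sg j * sg N by rewrite sgN mulr1.
elim: N jN {sgN} => // N IH; rewrite ltnS leq_eqVlt => /predU1P[->|jN].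
  by rewrite big_nat1.
by rewrite big_nat_recr ?(ltnW jN)//= IH// mulrA -(mulrA (sg j) (sg N) (sg N)) sgsq mulr1.
Qed.

End steps.

(** * Approximation of a low-energy function by a step function *)

Section approximation.
Variable R : realType.
Local Notation mu := (@lebesgue_measure R).
Local Notation mR := (measurableTypeR R).
Implicit Types (D B : set mR) (f g u v phi : R -> R) (a b c d : R).

Lemma count_iota_natr (p : pred nat) n :
  (count p (iota 0 n))%:R = \sum_(i < n) (p i)%:R :> R.
Proof.
elim: n => [|n IH]; first by rewrite big_ord0.
by rewrite -addn1 iotaD count_cat natrD IH addn1 big_ord_recr/= add0n addn0.
Qed.

Lemma in_L1_norm_dist1 c d u : in_L1 `]c, d[ u -> in_L1 `]c, d[ (fun x => `| `|u x| - 1|).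
Proof.
move=> uI; have mJ : measurable (`]c, d[%classic : set mR) by exact: measurable_itv.
have uI' := in_L1_norm mJ uI.
by apply: (in_L1_norm mJ); apply: (in_L1B mJ uI'); exact: in_L1_cst.
Qed.

(** Cells of energy below the threshold [dl] have a sign.  Applied to the union of
    two adjacent cells, this shows that the sign changes only where the energy
    of the pair reaches [dl]: hence the bound on the number of jumps, the
    extra 1 being a possible jump at [b].  In a cell with a sign,
    [`|u - sg| = `|`|u| - 1|]; in the others the excess is at most twice the length
    of the cell, and it is charged to their energy. *)
Lemma approx_by_steps (W : R -> R) (w eps : R) a b u (N : nat) (l C : R) :
  0 < w -> (forall s, w * (`|s| - 1) ^+ 2 <= W s) -> 0 < eps -> a < b ->
  (0 < N)%N -> l = (b - a) / N%:R -> eps / 2 <= l <= eps ->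
  W22 `]a, b[ u -> in_L1 `]a, b[ (W \o u) ->
  cell_energy W eps u (wderiv `]a, b[ u) a b <= C ->
  let dl := Num.min (w / 8) (16^-1) in
  exists ts : seq R, [/\ forall t, t \in ts -> a <= t <= b,
    (size ts)%:R <= 1 + 2 * C / dl &
    \int[mu]_(x in `]a, b[) `|u x - step ts x| <=
    \int[mu]_(x in `]a, b[) `| `|u x| - 1| + 2 * eps * C / dl].
Proof.
move=> w0 Ww e0 ab N0 lE /andP[l1 l2] uW WI EC dl.
have dl0 : 0 < dl by rewrite lt_min divr_gt0//= invr_gt0.
have mI : measurable (`]a, b[%classic : set mR) by exact: measurable_itv.
have mJ c d : measurable (`]c, d[%classic : set mR) by exact: measurable_itv.
have l0 : 0 < l by lra.
have bE : b = a + l * N%:R by rewrite lE divfK ?pnatr_eq0 -?lt0n// addrC subrK.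
set v := wderiv `]a, b[ u in EC.
have uv : weak_derivative `]a, b[ u v := wderivP uW.1.
have uI : in_L1 `]a, b[ u by apply: in_L2_L1; case: uW => -[].
have v2I : in_L1 `]a, b[ (fun x => v x ^+ 2) by case: uv => -[].
have W0 s : 0 <= W s by apply: le_trans (Ww s); rewrite mulr_ge0 ?sqr_ge0// ltW.
pose x i := a + l * i%:R.
have xS i : x i.+1 = x i + l by rewrite /x -natr1; ring.
have xle i j : (i <= j)%N -> x i <= x j.
  by move=> ij; rewrite lerD2l ler_pM2l// ler_nat.
have ax i : a <= x i by have := xle 0%N i (leq0n _); rewrite /x mulr0 addr0.
have xb i : (i <= N)%N -> x i <= b by rewrite bE => /xle.
have sub i j : (j <= N)%N -> `]x i, x j[%classic `<=` `]a, b[%classic.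
  by move=> jN; apply: subset_itv; rewrite bnd_simp ?ax ?xb.
have cells f : in_L1 `]a, b[ f -> \int[mu]_(t in `]a, b[) f t =
    \sum_(i < N) \int[mu]_(t in `]x i, x i.+1[) f t.
  by move=> fI; rewrite [in LHS]bE Rintegral_cells ?(ltW l0)// -bE.
pose E i := cell_energy W eps u v (x i) (x i.+1).
have E0 i : 0 <= E i.
  apply: addr_ge0; first by apply: divr_ge0; [exact: Rintegral_ge0|exact: ltW].
  apply: mulr_ge0; first exact: ltW.
  by apply: Rintegral_ge0 => t _; exact: sqr_ge0.
have sumE : \sum_(i < N) E i <= C.
  apply: le_trans EC; rewrite /cell_energy (cells _ WI) (cells _ v2I).
  by rewrite mulr_suml mulr_sumr -big_split.
have low i j : (j <= N)%N -> eps / 2 <= x j - x i <= 2 * eps ->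
    cell_energy W eps u v (x i) (x j) < dl ->
    pos_ae `]x i, x j[ u \/ neg_ae `]x i, x j[ u.
  move=> jN /andP[? ?]; apply: (low_energy_sign w0 Ww) => //.
  - exact: (in_L1_sub mI (mJ _ _) (sub _ _ jN) uI).
  - exact: (in_L1_sub mI (mJ _ _) (sub _ _ jN) WI).
  - exact: (weak_derivative_sub mI (mJ _ _) (sub _ _ jN) uv).
(* The fictitious value 1 on cell N turns a negative last cell into a jump
   at b, so that the product of the jumps is the sign itself. *)
pose sg i : R := if (i == N) || `[< pos_ae `]x i, x i.+1[ u >] then 1 else -1.
have sg1 i : sg i = 1 \/ sg i = -1 by rewrite /sg; case: ifP; [left|right].
have sgN : sg N = 1 by rewrite /sg eqxx.
have xlt i : x i < x i.+1 by rewrite xS ltrDl.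
have sg_pos i : pos_ae `]x i, x i.+1[ u -> sg i = 1.
  by move=> p; rewrite /sg (asboolT p) orbT.
have sg_neg i : (i < N)%N -> neg_ae `]x i, x i.+1[ u -> sg i = -1.
  move=> iN n; rewrite /sg ltn_eqF//= asboolF// => p.
  exact: not_pos_neg_ae p n.
have sg_pair i : (i.+1 < N)%N -> E i + E i.+1 < dl -> sg i = sg i.+1.
  move=> iN Ei.
  have Kl : x i.+2 - x i = 2 * l by rewrite !xS; ring.
  have KE : cell_energy W eps u v (x i) (x i.+2) = E i + E i.+1.
    have sp f : in_L1 `]a, b[ f -> \int[mu]_(t in `]x i, x i.+2[) f t =
        \int[mu]_(t in `]x i, x i.+1[) f t + \int[mu]_(t in `]x i.+1, x i.+2[) f t.
      move=> fI; apply: Rintegral_itv_split; first by rewrite !ltW.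
      by apply: in_L1_sub fI; [exact: mI|exact: mJ|exact: sub].
    by rewrite /E /cell_energy (sp _ WI) (sp _ v2I); ring.
  have s1 : `]x i, x i.+1[%classic `<=` `]x i, x i.+2[%classic.
    by apply: subset_itvl; rewrite bnd_simp ltW.
  have s2 : `]x i.+1, x i.+2[%classic `<=` `]x i, x i.+2[%classic.
    by apply: subset_itvr; rewrite bnd_simp ltW.
  have [||p|n] := low i i.+2 iN.
  - by rewrite Kl; apply/andP; split; lra.
  - by rewrite KE.
  - have p1 : pos_ae `]x i, x i.+1[ u by apply: (ae_mono _ p) => t + /s1.
    have p2 : pos_ae `]x i.+1, x i.+2[ u by apply: (ae_mono _ p) => t + /s2.
    by rewrite (sg_pos _ p1) (sg_pos _ p2).
  - have n1 : neg_ae `]x i, x i.+1[ u by apply: (ae_mono _ n) => t + /s1.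
    have n2 : neg_ae `]x i.+1, x i.+2[ u by apply: (ae_mono _ n) => t + /s2.
    by rewrite (sg_neg _ (ltnW iN) n1) (sg_neg _ iN n2).
pose ts := [seq x i.+1 | i <- iota 0 N & sg i != sg i.+1].
exists ts; split.
- move=> t /mapP[i]; rewrite mem_filter mem_iota add0n => /andP[_ /andP[_ iN]] ->.
  by rewrite ax xb.
- rewrite size_map size_filter count_iota_natr.
  case: N N0 sumE {lE bE xb sub cells low sg_neg} @sg sg1 sgN sg_pos sg_pair @ts => // N _ sumE sg sg1 sgN sg_pos sg_pair ts.
  rewrite big_ord_recr/= addrC lerD//; first by case: (_ != _).
  apply: (@le_trans _ _ (\sum_(i < N) (E i + E i.+1) / dl)).
    apply: ler_sum => i _; have [Ei|Ei] := ltP (E i + E i.+1) dl.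
      have iN : (i.+1 < N.+1)%N by rewrite ltnS ltn_ord.
      rewrite (sg_pair _ iN Ei) eqxx.
      by apply: divr_ge0; [exact: addr_ge0|exact: ltW].
    apply: (@le_trans _ _ 1); first by case: (_ != _).
    by rewrite ler_pdivlMr// mul1r.
  rewrite -mulr_suml ler_pM2r ?invr_gt0// big_split/= mulr_natl mulr2n.
  apply: lerD; apply: le_trans sumE.
    by rewrite big_ord_recr/= lerDl.
  by rewrite big_ord_recl/= lerDr.
- have mst c d : measurable_fun (`]c, d[%classic : set mR) (step ts).
    by apply: measurable_funTS; exact: measurable_step.
  have nst t : `|step ts t| <= 1 by rewrite norm_step.
  have stI c d : in_L1 `]c, d[ (step ts).
    exact: (in_L1_bounded (mst c d) (fun t _ => nst t)).
  have dI : in_L1 `]a, b[ (fun t => `|u t - step ts t|).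
    by apply: in_L1_norm => //; exact: in_L1B.
  rewrite (cells _ dI) (cells _ (in_L1_norm_dist1 uI)).
  apply: (@le_trans _ _ (\sum_(i < N)
      (\int[mu]_(t in `]x i, x i.+1[) `| `|u t| - 1| + 2 * eps * (E i / dl)))); last first.
    rewrite big_split/= lerD2l -mulr_sumr -mulr_suml -!mulrA ler_pM2l// ler_pM2l//.
    by rewrite ler_pM2r ?invr_gt0.
  apply: ler_sum => i _.
  have uJ : in_L1 `]x i, x i.+1[ u by apply: in_L1_sub uI => //; exact: sub.
  have nJ := in_L1_norm_dist1 uJ.
  have sJ : in_L1 `]x i, x i.+1[ (fun t => `|u t - sg i|).
    by apply: in_L1_norm => //; apply: in_L1B => //; exact: in_L1_cst.
  rewrite (_ : \int[mu]_(t in _) `|u t - step ts t| =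
      \int[mu]_(t in `]x i, x i.+1[) `|u t - sg i|); last first.
    apply: eq_Rintegral => t /set_mem/=; rewrite in_itv/= => tJ.
    by rewrite (step_cell (ltW l0) sg1 sgN (ltn_ord i) tJ).
  have [Ei|Ei] := ltP (E i) dl.
    apply: (@le_trans _ _ (\int[mu]_(t in `]x i, x i.+1[) `| `|u t| - 1|)); last first.
      by rewrite lerDl; apply: mulr_ge0; [rewrite mulr_ge0// ltW|rewrite divr_ge0// ltW].
    have [|p|n] := low i i.+1 (ltn_ord i) _ Ei.
    + by rewrite xS; apply/andP; split; lra.
    + rewrite (sg_pos _ p) in sJ *.
      apply: le_ae_Rintegral => //; apply: ae_mono p => t ut tJ /=.
      by rewrite (gtr0_norm (ut tJ)).
    + rewrite (sg_neg _ (ltn_ord i) n) in sJ *.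
      apply: le_ae_Rintegral => //; apply: ae_mono n => t ut tJ /=.
      by rewrite (ltr0_norm (ut tJ)) opprK -normrN opprD.
  apply: (@le_trans _ _ (\int[mu]_(t in `]x i, x i.+1[) (`| `|u t| - 1| + 2))).
    apply: le_Rintegral => //; first by apply: in_L1D => //; exact: in_L1_cst.
    move=> t _; have h1 : `|sg i| <= 1 by case: (sg1 i) => ->; rewrite ?normrN normr1.
    have := ler_normB (u t) (sg i); have := ler_norm (`|u t| - 1); lra.
  rewrite RintegralD//; last exact: in_L1_cst.
  rewrite lerD2l (Rintegral_cst_itv _ (ltW (xlt i))).
  have -> : x i.+1 - x i = l by rewrite xS; ring.
  rewrite -mulrA ler_pM2l//; apply: le_trans l2 _.
  by rewrite ler_pMr// ler_pdivlMr// mul1r.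
Qed.

End approximation.

(** * Compactness and bounded variation of step functions *)

Section compactness.
Variable R : realType.
Local Notation mu := (@lebesgue_measure R).
Local Notation mR := (measurableTypeR R).
Implicit Types (x y : R) (M : nat) (tau : nat -> R).

Definition alternation M tau x : R := \prod_(i < M) flip (tau i) x.

Lemma norm_alternation M tau x : `|alternation M tau x| = 1.
Proof. by rewrite /alternation normr_prod big1// => i _; exact: norm_flip. Qed.

Lemma alternationS M tau x :
  alternation M.+1 tau x = alternation M tau x * flip (tau M) x.
Proof. by rewrite /alternation big_ord_recr. Qed.

Lemma measurable_alternation M tau : measurable_fun setT (alternation M tau).
Proof.
elim: M => [|M IH].
  rewrite (_ : alternation 0 tau = cst 1); first exact: measurable_cst.
  by apply/funext => x; rewrite /alternation big_ord0.
rewrite (_ : alternation M.+1 tau = alternation M tau \* flip (tau M)).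
  by apply: measurable_funM => //; exact: measurable_flip.
by apply/funext => x; rewrite alternationS.
Qed.

(** A jump at [a] is invisible to the right of [a], so lists of jumps can be
    padded to a common length [M]. *)
Lemma step_alternation (ts : seq R) (a x : R) M : (size ts <= M)%N -> a <= x ->
  step ts x = alternation M (nth a ts) x.
Proof.
move=> sM ax; rewrite /step (big_nth a) /alternation -(big_mkord xpredT (fun i => flip (nth a ts i) x)).
rewrite (big_cat_nat (leq0n _) sM)/= [X in _ = _ * X]big_nat [X in _ = _ * X]big1 ?mulr1//.
by move=> i /andP[si _]; rewrite nth_default// /flip ax.
Qed.

Lemma incr_homo (f : nat -> nat) : increasing_seq f -> {homo f : m n / (m < n)%N}.
Proof. by move=> fi m n mn; have := leqW_mono fi m n; rewrite mn. Qed.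

Lemma homo_cvg_infty (f : nat -> nat) : {homo f : m n / (m < n)%N} -> f n @[n --> \oo] --> \oo.
Proof.
move=> fi; have nf n : (n <= f n)%N.
  by elim: n => // n IH; apply: leq_ltn_trans IH (fi _ _ (ltnSn n)).
move=> A [N _ NA]; exists N => // n /= Nn; apply: NA => /=.
exact: leq_trans Nn (nf n).
Qed.

(** Bolzano-Weierstrass for one jump point after the other: passing to a
    further subsequence keeps the limits already obtained. *)
Lemma extract_alternation (a b : R) M (tau : nat -> nat -> R) :
  (forall n i, a <= tau n i <= b) ->
  exists s (L : nat -> R), [/\ {homo s : m n / (m < n)%N},
    forall i, a <= L i <= b &
    forall i, (i < M)%N -> tau (s n) i @[n --> \oo] --> L i].
Proof.
move=> tab; elim: M => [|M [s [L [si Lab sL]]]].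
  by exists id, (tau 0%N); split => // i; rewrite ltn0.
have [|f fi /cvg_ex[/= l fl]] := @bolzano_weierstrass R (fun n => tau (s n) M).
  exists (`|a| + `|b|); split; first exact: num_real.
  move=> y aby n _ /=; apply: le_trans (ltW aby).
  have /andP[h1 h2] := tab (s n) M; rewrite ler_norml.
  have := ler_norm b; have := ler_norm (- a); rewrite normrN => ? ?.
  have := normr_ge0 a; have := normr_ge0 b => ? ?; apply/andP; split; lra.
have fi' := incr_homo fi.
exists (s \o f), (fun i => if (i < M)%N then L i else l); split.
- by move=> m n mn /=; apply/si/fi'.
- move=> i; case: ifP => // _; apply/andP; split.
    rewrite -(cvg_lim _ fl)//; apply: limr_ge; first exact: cvgP fl.
    by apply: nearW => n /=; case/andP: (tab (s (f n)) M).
  rewrite -(cvg_lim _ fl)//; apply: limr_le; first exact: cvgP fl.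
  by apply: nearW => n /=; case/andP: (tab (s (f n)) M).
- move=> i; rewrite ltnS leq_eqVlt => /predU1P[->|iM]; first by rewrite ltnn.
  rewrite iM; apply: (cvg_comp _ _ (homo_cvg_infty fi') (sL _ iM)).
Qed.

(** Away from the limit jump, the sequence is eventually constant. *)
Lemma cvg_flip (t : nat -> R) (l x : R) : t n @[n --> \oo] --> l -> x != l ->
  flip (t n) x @[n --> \oo] --> flip l x.
Proof.
move=> tl xl; apply: cvg_near_cst.
have d0 : 0 < `|x - l| by rewrite normr_gt0 subr_eq0.
apply: filterS (cvgr_dist_lt _ _ tl _ d0) => n /=.
rewrite distrC => tn; rewrite /flip.
suff -> : (t n <= x) = (l <= x) by [].
move: tn; rewrite ltr_norml; case: (leP l x) => lx.
  by rewrite ger0_norm ?subr_ge0// => /andP[? ?]; apply/idP; lra.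
by rewrite ltr0_norm ?subr_lt0// => /andP[? ?]; apply/negbTE; rewrite -ltNge; lra.
Qed.

Lemma cvg_alternation M (tau : nat -> nat -> R) (L : nat -> R) :
  (forall i, (i < M)%N -> tau n i @[n --> \oo] --> L i) ->
  {ae mu, forall x, alternation M (tau n) x @[n --> \oo] --> alternation M L x}.
Proof.
elim: M => [_|M IH tL].
  apply: aeW => x; rewrite /alternation big_ord0.
  by under eq_fun do rewrite big_ord0; exact: cvg_cst.
have h1 : {ae mu, forall x, x != L M}.
  exists [set L M]; split => //; first exact: lebesgue_measure_set1.
  by move=> x /= /negP/negPn/eqP.
apply: ae_mono (ae_and (IH _) h1) => [|i iM]; last by apply: tL; exact: ltnW.
move=> x [cx xL]; rewrite alternationS; under eq_fun do rewrite alternationS.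
by apply: cvgM => //; apply: cvg_flip xL; exact: tL.
Qed.

Lemma in_L1_alternation (a b : R) M tau : in_L1 `]a, b[ (alternation M tau).
Proof.
apply: (@in_L1_bounded _ a b 1) => [|t ?]; last by rewrite norm_alternation.
by apply: measurable_funTS; exact: measurable_alternation.
Qed.

Lemma cvg_L1_alternation (a b : R) M (tau : nat -> nat -> R) (L : nat -> R) :
  (forall i, (i < M)%N -> tau n i @[n --> \oo] --> L i) ->
  \int[mu]_(x in `]a, b[) `|alternation M (tau n) x - alternation M L x|
    @[n --> \oo] --> (0 : R).
Proof.
move=> tL; have mI : measurable (`]a, b[%classic : set mR) by exact: measurable_itv.
have mA t : measurable_fun (`]a, b[%classic : set mR) (fun x => (alternation M t x)%:E).
  by apply: measurable_int (in_L1_alternation a b M t).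
(* Dominated convergence: the sequence converges off the limit jumps and is
   bounded by 1. *)
have ae_cvg : {ae mu, forall x, `]a, b[%classic x ->
    (alternation M (tau n) x)%:E @[n --> \oo] --> (alternation M L x)%:E}.
  apply: ae_mono (cvg_alternation tL) => x cx _.
  by apply: cvg_EFin; [exact: nearW|exact: cx].
have ae_le : {ae mu, forall x, forall n, `]a, b[%classic x ->
    (`|(alternation M (tau n) x)%:E| <= cst 1 x)%E}.
  by apply: aeW => x n _; rewrite /= lee_fin norm_alternation.
have [_ + _] := @dominated_convergence _ _ R mu _ mI
  (fun n x => (alternation M (tau n) x)%:E) (fun x => (alternation M L x)%:E) (cst 1%E)
  (fun n => mA _) (mA _) ae_cvg (in_L1_cst a b 1) ae_le.
move=> /fine_cvgP[_]; apply: cvg_trans; apply: near_eq_cvg; apply: nearW => n.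
by rewrite /Rintegral/=.
Qed.

Definition heaviside r x : R := if r <= x then 1 else 0.

(** By the fundamental theorem of calculus the integral is
    [phi b - phi r]. *)
Lemma heaviside_variation (a b : R) phi r : test_function `]a, b[ phi ->
  (forall x, `|phi x| <= 1) -> a <= r <= b ->
  `|\int[mu]_(x in `]a, b[) (heaviside r x * derive1 phi x)| <= 2.
Proof.
move=> phit phi1 /andP[ar rb].
have mJ c d : measurable (`]c, d[%classic : set mR) by exact: measurable_itv.
have [_ [C phiC]] := test_function_bounded phit.
have [dphi cphi _ _] := phit.
have mphi c d : measurable_fun (`]c, d[%classic : set mR) (derive1 phi).
  by apply: measurable_funTS; exact: continuous_measurable_fun.
have phiI c d : in_L1 `]c, d[ (derive1 phi) := in_L1_bounded (mphi c d) (fun t _ => phiC t).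
have mH : measurable_fun setT (heaviside r).
  by apply: measurable_fun_ifT => //; apply: measurable_fun_ler => //; exact: measurable_id.
have mH' : measurable_fun (`]a, b[%classic : set mR) (heaviside r).
  by apply: measurable_funTS; exact: mH.
have H1 t : `]a, b[%classic t -> `|heaviside r t| <= 1.
  by move=> _; rewrite /heaviside; case: ifP; rewrite ?normr0 ?normr1.
have HI : in_L1 `]a, b[ (fun x => heaviside r x * derive1 phi x).
  suff -> : (fun x => heaviside r x * derive1 phi x) =
      (fun x => derive1 phi x * heaviside r x).
    exact: in_L1_mul_bounded (mJ a b) (phiI a b) mH' H1.
  by apply/funext => x; rewrite mulrC.
rewrite (@Rintegral_itv_split _ a r b)//; last by rewrite ar.
rewrite (_ : \int[mu]_(x in `]a, r[) _ = 0) ?add0r; last first.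
  rewrite (@eq_Rintegral _ _ _ _ _ (fun=> 0)) ?Rintegral_cst ?mul0r//.
  move=> x /set_mem; rewrite /= in_itv/= => /andP[_ xr].
  by rewrite /heaviside leNgt xr mul0r.
rewrite (@eq_Rintegral _ mR _ mu _ (derive1 phi)); last first.
  move=> x /set_mem; rewrite /= in_itv/= => /andP[rx _].
  by rewrite /heaviside ltW// mul1r.
move: rb; rewrite le_eqVlt => /predU1P[->|rb].
  by rewrite set_itv_ge ?Rintegral_set0 ?normr0// bnd_simp ltxx.
have dphi' x : is_derive x 1 phi (derive1 phi x).
  by rewrite derive1E; apply: DeriveDef.
rewrite (Rintegral_derive1 rb dphi' cphi).
by apply: le_trans (ler_normB _ _) _; rewrite -[2]/(1 + 1 : R) lerD.
Qed.

(** Induction on the number of jumps, carrying a Heaviside factor along: the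
    product of two Heaviside functions is the one of the larger threshold, so
    multiplying by [flip t = 2 * heaviside t - 1] at most triples the bound. *)
Lemma alternation_variation (a b : R) M tau r phi : test_function `]a, b[ phi ->
  (forall x, `|phi x| <= 1) -> (forall i, a <= tau i <= b) -> a <= r <= b ->
  `|\int[mu]_(x in `]a, b[) (alternation M tau x * (heaviside r x * derive1 phi x))|
    <= 2 * 3 ^+ M.
Proof.
move=> phit phi1 tab.
have mI : measurable (`]a, b[%classic : set mR) by exact: measurable_itv.
have [_ [C phiC]] := test_function_bounded phit.
have [_ cphi _ _] := phit.
have phiI : in_L1 `]a, b[ (derive1 phi).
  apply: (in_L1_bounded _ (fun t _ => phiC t)).
  by apply: measurable_funTS; exact: continuous_measurable_fun.
have HI M' r' : in_L1 `]a, b[ (fun x => alternation M' tau x * (heaviside r' x * derive1 phi x)).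
  have mK : measurable_fun (`]a, b[%classic : set mR) (fun x => alternation M' tau x * heaviside r' x).
    apply: measurable_funTS; apply: measurable_funM; first exact: measurable_alternation.
    by apply: measurable_fun_ifT => //; apply: measurable_fun_ler => //; exact: measurable_id.
  have K1 t : `]a, b[%classic t -> `|alternation M' tau t * heaviside r' t| <= 1.
    by move=> _; rewrite normrM norm_alternation mul1r /heaviside; case: ifP; rewrite ?normr0 ?normr1.
  suff -> : (fun x => alternation M' tau x * (heaviside r' x * derive1 phi x)) =
      (fun x => derive1 phi x * (alternation M' tau x * heaviside r' x)).
    exact: in_L1_mul_bounded mI phiI mK K1.
  by apply/funext => x; ring.
elim: M r => [|M IH] r rab.
  rewrite expr0 mulr1; under eq_Rintegral do rewrite /alternation big_ord0 mul1r.
  exact: heaviside_variation.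
rewrite (@eq_Rintegral _ mR _ mu _ (fun x =>
    2 * (alternation M tau x * (heaviside (Num.max (tau M) r) x * derive1 phi x)) -
    alternation M tau x * (heaviside r x * derive1 phi x))); last first.
  move=> x _; rewrite alternationS /flip /heaviside ge_max.
  by case: (tau M <= x); case: (r <= x) => /=; ring.
have H2 := in_L1Z 2 mI (HI M (Num.max (tau M) r)).
rewrite (RintegralB mI H2 (HI M r)) (RintegralZl _ mI (HI _ _)).
apply: le_trans (ler_normB _ _) _; rewrite normrM (ger0_norm (x := 2))//.
have := IH _ rab.
have : a <= Num.max (tau M) r <= b.
  by rewrite le_max ge_max; have /andP[-> ->] := tab M; case/andP: rab => _ ->.
by move=> /IH; rewrite exprS; lra.
Qed.

Lemma BV_pm1_alternation (a b : R) M tau : a < b -> (forall i, a <= tau i <= b) ->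
  BV_pm1 `]a, b[ (alternation M tau).
Proof.
move=> ab tab; split; last first.
  apply: aeW => x _; have := norm_alternation M tau x.
  by case: (leP 0 (alternation M tau x)) => h; [rewrite ger0_norm//; right|rewrite ltr0_norm// => <-; left; rewrite opprK].
split; first exact: in_L1_alternation.
apply: (@le_lt_trans _ _ (2 * 3 ^+ M)%:E); last exact: ltry.
apply: ge_ereal_sup => _ /= [phi [phit phi1] <-]; rewrite lee_fin.
have aab : a <= a <= b by rewrite lexx ltW.
apply: le_trans (ler_norm _) _.
apply: le_trans (alternation_variation M phit phi1 tab aab).
rewrite le_eqVlt; apply/orP; left; apply/eqP; congr `|_|.
apply: eq_Rintegral => x /set_mem; rewrite /= in_itv/= => /andP[ax _].
by rewrite /heaviside ltW// mul1r.
Qed.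

End compactness.

(** * Distance to the wells and choice of the scale *)

Section well_distance.
Variable R : realType.
Local Notation mu := (@lebesgue_measure R).
Local Notation mR := (measurableTypeR R).

(** Young's inequality with weight [Num.sqrt eps], and the quadratic growth of [W]
    at the wells. *)
Lemma well_distance (W : R -> R) (w eps C a b : R) (u : R -> R) :
  0 < w -> (forall s, w * (`|s| - 1) ^+ 2 <= W s) -> 0 < eps -> a < b ->
  in_L1 `]a, b[ u -> in_L1 `]a, b[ (W \o u) ->
  \int[mu]_(x in `]a, b[) W (u x) <= eps * C ->
  \int[mu]_(x in `]a, b[) `| `|u x| - 1| <=
  Num.sqrt eps * ((b - a) / 2 + C / (2 * w)).
Proof.
move=> w0 Ww e0 ab uI WI WC.
have mI : measurable (`]a, b[%classic : set mR) by exact: measurable_itv.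
set t := Num.sqrt eps; have t0 : 0 < t by rewrite sqrtr_gt0.
have tt : t * t = eps by rewrite -expr2 sqr_sqrtr// ltW.
have gI : in_L1 `]a, b[ (fun x => t / 2 + (2 * w * t)^-1 * W (u x)).
  by apply: in_L1D => //; [exact: in_L1_cst|exact: in_L1Z].
apply: (@le_trans _ _ (\int[mu]_(x in `]a, b[) (t / 2 + (2 * w * t)^-1 * W (u x)))).
  apply: le_Rintegral => //; first exact: in_L1_norm_dist1.
  move=> x _; apply: (@le_trans _ _ (t / 2 + (2 * w * t)^-1 * (w * (`|u x| - 1) ^+ 2))).
    rewrite -(ler_pM2l (x := 2 * t)) ?mulr_gt0//.
    have -> : 2 * t * (t / 2 + (2 * w * t)^-1 * (w * (`|u x| - 1) ^+ 2)) =
        t ^+ 2 + (`|u x| - 1) ^+ 2 by field; rewrite !gt_eqF.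
    rewrite -(real_normK (num_real (`|u x| - 1))).
    by have := sqr_ge0 (t - `| `|u x| - 1|); nra.
  by rewrite lerD2l ler_pM2l// invr_gt0 !mulr_gt0.
rewrite RintegralD//; [|exact: in_L1_cst|exact: in_L1Z].
rewrite (Rintegral_cst_itv _ (ltW ab)) RintegralZl// [leRHS]mulrDr lerD//.
  by rewrite le_eqVlt; apply/orP; left; apply/eqP; ring.
have t2 : 0 <= (2 * w * t)^-1 by rewrite invr_ge0 !mulr_ge0// ltW.
apply: le_trans (ler_wpM2l t2 WC) _.
rewrite -tt le_eqVlt; apply/orP; left; apply/eqP; field.
by rewrite !gt_eqF.
Qed.

(** With [L] the length of the interval, the cells have length [l] with
    [L * eps / (L + eps) <= l <= eps], so that [eps / l] tends to 1 and eventually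
    [(eps / l) ^+ 2] is below [(k + k0) / (2 * k)], a number larger than 1. *)
Lemma cell_scale (a b eps k k0 : R) : a < b -> 0 < k -> k < k0 -> 0 < eps ->
  eps <= b - a -> 6 * k * eps <= (b - a) * (k0 - k) ->
  exists N : nat, let l := (b - a) / N%:R in
    [/\ (0 < N)%N, eps / 2 <= l <= eps &
     eps ^+ 2 * k <= l ^+ 2 * ((k + k0) / 2)].
Proof.
move=> ab kpos kk0 e0 eL e6; set L := b - a in eL e6 *.
have L0 : 0 < L by rewrite subr_gt0.
have Le0 : 0 <= L / eps by apply/ltW/divr_gt0.
exists (Num.truncn (L / eps)).+1 => l.
have /andP[n1 n2] := truncn_itv Le0.
set N := (Num.truncn _).+1 in l n2 *.
have N0 : 0 < N%:R :> R by rewrite ltr0n.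
have lN : l * N%:R = L by rewrite /l divfK// gt_eqF.
have l0 : 0 < l by rewrite divr_gt0.
have l_le : l <= eps.
  by rewrite ler_pdivrMr// -ler_pdivrMl// mulrC ltW.
have NL : N%:R * eps <= L + eps.
  rewrite /N -natr1 mulrDl mul1r lerD2r.
  by rewrite -ler_pdivlMr.
have el : L * eps <= l * (L + eps).
  by rewrite -{1}lN -mulrA ler_pM2l.
have el2 : eps <= 2 * l.
  rewrite -(ler_pM2l L0); apply: le_trans el _.
  have -> : L * (2 * l) = l * (L + L) by ring.
  by rewrite ler_pM2l// lerD2l.
split => //.
  by rewrite l_le andbT; lra.
rewrite -(ler_pM2l (x := L ^+ 2)) ?exprn_gt0//.
apply: (@le_trans _ _ ((l * (L + eps)) ^+ 2 * k)).
  rewrite mulrA -exprMn ler_pM2r// lerXn2r// nnegrE.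
    by apply/ltW/mulr_gt0.
  by apply/ltW/mulr_gt0 => //; exact: addr_gt0.
have -> : L ^+ 2 * (l ^+ 2 * ((k + k0) / 2)) = l ^+ 2 * (L ^+ 2 * ((k + k0) / 2)) by ring.
rewrite exprMn -mulrA ler_pM2l ?exprn_gt0//.
have h1 : eps ^+ 2 <= L * eps by rewrite expr2 ler_pM2r.
have h2 : 6 * k * eps * L <= L * (k0 - k) * L by rewrite ler_pM2r.
have h3 : eps ^+ 2 * k <= L * eps * k by rewrite ler_pM2r.
nra.
Qed.

End well_distance.

(** * The compactness theorem *)

Theorem proposition3p4 (R : realType) (W : R -> R) (a b k0 k : R)
    (eps : nat -> R) (u_ : nat -> R -> R)
    (W_double_well : double_well W)
    (a_lt_b : a < b)
    (k0_gt0 : 0 < k0) (k0_interp : nonlinear_interpolation W k0)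
    (k_gt0 : 0 < k) (k_lt_k0 : k < k0)
    (eps_gt0 : forall n, 0 < eps n)
    (eps_cvg0 : eps n @[n --> \oo] --> (0 : R))
    (u_W22 : forall n, W22 `]a, b[ (u_ n))
    (energy_bounded :
      (ereal_sup [set energy W `]a, b[ k (eps n) (u_ n) | n in [set: nat]]
        < +oo)%E) :
  exists (s : nat -> nat) (u : R -> R),
    [/\ {homo s : m n / (m < n)%N},
        BV_pm1 `]a, b[ u &
        cvg_L1 `]a, b[ (fun n => u_ (s n)) u].
Proof.
have [cW W0 _ _] := W_double_well.
have [w w0 Ww] := double_well_coercive W_double_well.
have mI : measurable (`]a, b[%classic : set (measurableTypeR R)) by exact: measurable_itv.
have [C0 C0_ge0 enC] : exists2 C0 : R, 0 <= C0 &
    forall n, (energy W `]a, b[ k (eps n) (u_ n) <= C0%:E)%E.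
  move: energy_bounded; set S := ereal_sup _ => Sy.
  have Sub n : (energy W `]a, b[ k (eps n) (u_ n) <= S)%E.
    by apply: ereal_sup_ubound; exists n.
  exists `|fine S| => // n; apply: le_trans (Sub n) _.
  by move: Sy; case: (S) => [r _||] //=; rewrite ?leNye// lee_fin ler_norm.
(* The uniform bound for the integral of W (u) / eps + eps u'^2, from
   energy_coercive. *)
pose C1 := (1 + k^-1) * (C0 * (2 * k0 / (k0 - k))).
have C1_ge0 : 0 <= C1.
  apply: mulr_ge0; first by rewrite addr_ge0// invr_ge0 ltW.
  by apply: mulr_ge0 => //; apply/ltW/divr_gt0; [exact: mulr_gt0|rewrite subr_gt0].
pose dl := Num.min (w / 8) (16^-1).
have dl0 : 0 < dl by rewrite lt_min divr_gt0//= invr_gt0.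
pose err (e : R) := Num.sqrt e * ((b - a) / 2 + C1 / (2 * w)) + 2 * e * C1 / dl.
have uI n : in_L1 `]a, b[ (u_ n) by apply: in_L2_L1; case: (u_W22 n) => -[].
have approx n : eps n <= b - a -> 6 * k * eps n <= (b - a) * (k0 - k) ->
    exists ts : seq R, [/\ forall t, t \in ts -> a <= t <= b,
      (size ts)%:R <= 1 + 2 * C1 / dl &
      \int[@lebesgue_measure R]_(x in `]a, b[) `|u_ n x - step ts x| <= err (eps n)].
  move=> e1 e2; have [N [N0 lN qN]] := cell_scale a_lt_b k_gt0 k_lt_k0 (eps_gt0 n) e1 e2.
  have [WI en] := energy_le_split cW W0 (eps_gt0 n) (u_W22 n) (enC n).
  have int2 := interpolation_cells k0_interp a_lt_b N0 (u_W22 n) WI erefl.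
  have l0 : 0 < (b - a) / N%:R by rewrite divr_gt0 ?subr_gt0 ?ltr0n.
  have le_e : (b - a) / N%:R <= eps n by case/andP: lN.
  have sq0 (f : R -> R) : 0 <= \int[@lebesgue_measure R]_(x in `]a, b[) (f x ^+ 2).
    by apply: Rintegral_ge0 => x _; exact: sqr_ge0.
  have A0 : 0 <= \int[@lebesgue_measure R]_(x in `]a, b[) W (u_ n x) by exact: Rintegral_ge0.
  have EC := energy_coercive k_gt0 k_lt_k0 C0_ge0 l0 le_e qN A0 (sq0 _) (sq0 _) int2 en.
  have [ts [tsab tsM tsL]] := approx_by_steps w0 Ww (eps_gt0 n) a_lt_b N0 erefl lN
    (u_W22 n) WI EC.
  exists ts; split => //; apply: le_trans tsL _; rewrite /err lerD2r.
  apply: (well_distance w0 Ww) => //.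
  rewrite mulrC -ler_pdivrMr//; apply: le_trans EC.
  by rewrite lerDl mulr_ge0// ltW.
(* The scale condition of cell_scale holds from some index n0 on. *)
have [n0 approx0] : exists n0, forall n, exists ts : seq R,
    [/\ forall t, t \in ts -> a <= t <= b, (size ts)%:R <= 1 + 2 * C1 / dl &
      \int[@lebesgue_measure R]_(x in `]a, b[) `|u_ (n0 + n)%N x - step ts x| <=
      err (eps (n0 + n)%N)].
  have d0 : 0 < Num.min (b - a) ((b - a) * (k0 - k) / (6 * k)).
    by rewrite lt_min subr_gt0 a_lt_b/= divr_gt0 ?mulr_gt0 ?subr_gt0.
  have [n0 _ near_n0] := cvgr_lt _ eps_cvg0 _ d0.
  exists n0 => n; have := near_n0 (n0 + n)%N (leq_addr _ _).
  rewrite lt_min => /andP[e1 e2]; apply: approx; first exact: ltW.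
  by rewrite mulrC -ler_pdivlMr ?mulr_gt0// ltW.
have /choice[ts tsP] := approx0.
pose M := (Num.truncn (1 + 2 * C1 / dl)).+1.
have tsM n : (size (ts n) <= M)%N.
  have [_ + _] := tsP n; rewrite -(ler_nat R) => /le_trans; apply.
  by rewrite ltW// truncnS_gt.
have tsab n i : a <= nth a (ts n) i <= b.
  have [ti|ti] := ltnP i (size (ts n)); last by rewrite nth_default// lexx ltW.
  by have [+ _ _] := tsP n; apply; exact: mem_nth.
have [s [L [s_incr Lab sL]]] := extract_alternation M tsab.
exists (fun n => n0 + s n)%N, (alternation M L); split.
- by move=> m n mn; rewrite ltn_add2l s_incr.
- exact: BV_pm1_alternation.
have AI := in_L1_alternation a b M.
have dI n : in_L1 `]a, b[ (fun x => `|u_ n x - alternation M L x|).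
  exact: (in_L1_norm mI (in_L1B mI (uI _) (AI _))).
rewrite /cvg_L1; under eq_fun do rewrite (EFin_Rintegral mI (dI _)).
apply: cvg_EFin; first exact: nearW.
pose h n := \int[@lebesgue_measure R]_(x in `]a, b[)
  `|alternation M (nth a (ts (s n))) x - alternation M L x|.
have h_cvg : h n @[n --> \oo] --> (0 : R) by exact: cvg_L1_alternation.
have eps_s : eps (n0 + s n)%N @[n --> \oo] --> (0 : R).
  apply: (cvg_comp _ _ _ eps_cvg0); apply: homo_cvg_infty => m n mn.
  by rewrite ltn_add2l s_incr.
have err_cvg : err (eps (n0 + s n)%N) + h n @[n --> \oo] --> (0 : R).
  rewrite -[X in _ --> X]addr0; apply: cvgD => //.
  rewrite -[X in _ --> X]addr0; apply: cvgD.
    rewrite -[X in _ --> X](mul0r ((b - a) / 2 + C1 / (2 * w))).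
    apply: cvgM; last exact: cvg_cst.
    by rewrite -(sqrtr0 R); apply: (cvg_comp _ _ eps_s); exact: sqrt_continuous.
  rewrite -[X in _ --> X](mul0r dl^-1); apply: cvgM; last exact: cvg_cst.
  rewrite -[X in _ --> X](mul0r C1); apply: cvgM; last exact: cvg_cst.
  by rewrite -[X in _ --> X](mulr0 2); apply: cvgM => //; exact: cvg_cst.
apply: (squeeze_cvgr _ (cvg_cst 0) err_cvg); apply: nearW => n.
apply/andP; split; first exact: Rintegral_ge0.
have [_ _ uts] := tsP (s n).
pose T x := alternation M (nth a (ts (s n))) x.
have uT : \int[@lebesgue_measure R]_(x in `]a, b[) `|u_ (n0 + s n)%N x - T x| <=
    err (eps (n0 + s n)%N).
  apply: le_trans uts; rewrite le_eqVlt; apply/orP; left; apply/eqP.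
  apply: eq_Rintegral => x /set_mem; rewrite /= in_itv/= => /andP[ax _].
  by rewrite (step_alternation (tsM _) (ltW ax)).
apply: le_trans (lerD uT (lexx (h n))); rewrite /h.
have i1 : in_L1 `]a, b[ (fun x => `|u_ (n0 + s n)%N x - T x|).
  exact: (in_L1_norm mI (in_L1B mI (uI _) (AI _))).
have i2 : in_L1 `]a, b[ (fun x => `|T x - alternation M L x|).
  exact: (in_L1_norm mI (in_L1B mI (AI _) (AI _))).
rewrite -(RintegralD mI i1 i2).
apply: (le_Rintegral mI (dI _) (in_L1D mI i1 i2)).
by move=> x _; exact: ler_distD.
Qed.
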